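(* Let $(M,g)$ be a Riemannian manifold and let $(N,h,J)$ be a Kähler manifold. Let $\{\psi_t\}$ be a one-parameter group of isometries of $(M,g)$ generated by a Killing vector field $W\in\Gamma(TM)$, and let $\{\phi_t\}$ be a one-parameter group of isometries of $(N,h)$ generated by a holomorphic Killing vector field $V\in\Gamma(TN)$. Let $v:M\to N$ be a smooth map independent of $t$, and let $u(t,x)=\phi_t\circ v\circ\psi_t(x)$ for $t\in[0,T)$, $x\in M$, where $0<T\le\infty$. Then: (i) $u$ is a geometric soliton of the Schrödinger flow $u_t=J(u)\tau_1(u)$ if and only if $v$ satisfies $$J(v)\,\tau_1(v)=V(v)+\nabla_W v \quad\text{on } M;$$ (ii) if $M$ is one-dimensional ($M=\mathbb{R}$ or $M=S^1$), $u$ is a geometric soliton of the geometric KdV flow $u_t=J(u)\tau_2(u)$ if and only if $v$ satisfies $$J(v)\,\tau_2(v)=V(v)+\nabla_W v \quad\text{on } M.$$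
   Context: **Generation of the groups.** ''$\{\phi_t\}$ is generated by $V$'' and ''$\{\psi_t\}$ is generated by $W$'' mean $\frac{d}{dt}\phi_t(y)=V(\phi_t(y))$ for all $y\in N$ with $\phi_0=\mathrm{id}_N$, and $\frac{d}{dt}\psi_t(x)=W(\psi_t(x))$ for all $x\in M$ with $\psi_0=\mathrm{id}_M$; both are groups in $t\in\mathbb{R}$. $V$ being holomorphic means that its flow is holomorphic, i.e. $J\circ d\phi_t=d\phi_t\circ J$ for all $t$. **Notation.** $J$ is the complex structure of the Kähler manifold $N$. $V(v)$ is the section $x\mapsto V(v(x))$ of the pull-back bundle $v^*TN$, and $\nabla_W v:=dv(W)$ is the derivative of $v$ in the direction $W$, also a section of $v^*TN$. **Schrödinger flow.** For a map $u:M\to N$, $\tau_1(u):=\mathrm{trace}_g\nabla du\in\Gamma(u^*TN)$ is the tension field. (If $N$ is isometrically embedded in $\mathbb{R}^K$, then $\tau_1(u)=\Delta u+A(u)(\nabla u,\nabla u)$, where $A$ is the second fundamental form of $N$.) The Schrödinger flow for $u:[0,T)\times M\to N$ is $u_t=J(u)\tau_1(u)$, with $\tau_1$ taken in the $x$ variable. **Geometric KdV flow.** Here $M=\mathbb{R}$ or $M=S^1$, with arc-length coordinate $x$ with respect to $g$. For a map $u:M\to N$, let $u_x=du(\partial_x)$, let $\nabla_x$ be the covariant derivative along $u$ induced by the Levi-Civita connection of $h$, and let $R$ be the curvature tensor of $N$ (with the sign convention for which, on a surface with Gauss curvature $G$, $R(X,JX)JX=G|X|^2X$). Define $$\tau_2(u):=-J\nabla_x^2u_x+\tfrac12R(u_x,Ju_x)u_x\in\Gamma(u^*TN).$$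 The geometric KdV flow for $u:[0,T)\times M\to N$ is $u_t=J(u)\tau_2(u)$. **Geometric soliton.** A solution $u$ of the Schrödinger flow (respectively the geometric KdV flow) is called a geometric soliton if there exist two one-parameter groups of isometries $\psi_t:M\to M$ and $\phi_t:N\to N$ and a map $v:M\to N$ independent of $t$ such that $u(t,x)=\phi_t\circ v\circ\psi_t(x)$. In particular, being a geometric soliton of a flow includes being a solution of that flow. *)

(* Defs.v *)
From HB Require Import structures.
From mathcomp Require Import all_boot all_order all_algebra.
From mathcomp Require Import all_classical all_reals all_analysis.
Set Implicit Arguments.
Unset Strict Implicit.
Unset Printing Implicit Defensive.
Import Order.TTheory GRing.Theory Num.Theory.
Import numFieldNormedType.Exports.
Local Open Scope classical_set_scope.
Local Open Scope ring_scope.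

(* Conventions.  Vectors are row vectors.  An atlas is given as a family of
   charts indexed by the points of the manifold, the chart [chart p] being
   defined around [p]; any atlas contains such a subfamily, which defines the
   same smooth (or complex) structure.  The tangent space T_p M is R^n, a
   tangent vector at [p] being given by its components in the chart [chart p].
   Hence a vector field on [M], or a section of a pull-back bundle u^*TN with
   [u : M -> N], is a function on [M] with values in row vectors, and a linear
   map between tangent spaces acts by right multiplication. *)

Section EuclideanSmoothness.
Context {R : realType} {m : nat} {W : normedModType R}.

Definition basis_vec (i : 'I_m) : 'rV[R]_m := delta_mx 0 i.

(* [U] is meant to be open *)
Fixpoint Ck (k : nat) (U : set 'rV[R]_m) (f : 'rV[R]_m -> W) : Prop :=
  if k is k'.+1 then
    (forall x, U x -> differentiable f x) /\
    (forall i, Ck k' U ('D_(basis_vec i) f))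
  else forall x, U x -> {for x, continuous f}.

(* Smoothness on an arbitrary set [A]: existence of local smooth extensions. *)
Definition smooth_on (A : set 'rV[R]_m) (f : 'rV[R]_m -> W) : Prop :=
  forall x, A x -> exists (O : set 'rV[R]_m) (F : 'rV[R]_m -> W),
    [/\ open O, O x, forall k, Ck k O F &
        forall y, O y -> A y -> F y = f y].

End EuclideanSmoothness.

Record manifold (R : realType) (n : nat) := Manifold {
  carrier :> topologicalType ;
  cdom : carrier -> set carrier ;
  ccod : carrier -> set 'rV[R]_n ;
  chart : carrier -> carrier -> 'rV[R]_n ;
  ichart : carrier -> 'rV[R]_n -> carrier ;
  manifold_hausdorff : hausdorff_space carrier ;
  manifold_second_countable : @second_countable carrier ;
  cdom_open : forall p, open (cdom p) ;
  ccod_open : forall p, open (ccod p) ;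
  mem_cdom : forall p, cdom p p ;
  chart_ccod : forall p x, cdom p x -> ccod p (chart p x) ;
  ichart_cdom : forall p y, ccod p y -> cdom p (ichart p y) ;
  chartK : forall p x, cdom p x -> ichart p (chart p x) = x ;
  ichartK : forall p y, ccod p y -> chart p (ichart p y) = y ;
  chart_continuous : forall p x, cdom p x -> {for x, continuous (chart p)} ;
  ichart_continuous : forall p y, ccod p y -> {for y, continuous (ichart p)} ;
  transition_smooth : forall p q,
    smooth_on (ccod p `&` ichart p @^-1` cdom q) (chart q \o ichart p) }.

Section Maps.
Context {R : realType}.

Definition smooth_map {m n} {M : manifold R m} {N : manifold R n}
    (f : M -> N) : Prop :=
  continuous f /\
  forall p q, smooth_on (ccod p `&` [set y | cdom q (f (ichart p y))])
                        (chart q \o f \o ichart p).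

Definition diffeomorphism {m n} {M : manifold R m} {N : manifold R n}
    (f : M -> N) : Prop :=
  smooth_map f /\
  exists f' : N -> M, [/\ cancel f f', cancel f' f & smooth_map f'].

(* [F], restricted to [I * M], is smooth as a map from (a subset of) the
   product manifold R * M, whose charts take values in R^(1 + m). *)
Definition smooth_family {m n} {M : manifold R m} {N : manifold R n}
    (I : set R) (F : R -> M -> N) : Prop :=
  {within [set z : R * M | I z.1], continuous (fun z : R * M => F z.1 z.2)} /\
  forall (p : M) (q : N),
    let G (z : 'rV[R]_(1 + m)) := F (lsubmx z 0 0) (ichart p (rsubmx z)) in
    smooth_on [set z : 'rV[R]_(1 + m) |
                 [/\ I (lsubmx z 0 0), ccod p (rsubmx z) & cdom q (G z)]]
              (chart q \o G).

Definition dmap {m n} {M : manifold R m} {N : manifold R n}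
    (f : M -> N) (x : M) : 'M[R]_(m, n) :=
  'J (chart (f x) \o f \o ichart x) (chart x x).

(* Components in the chart [chart p] of a tangent vector [X] at [q]. *)
Definition tcoord {n} {N : manifold R n} (p q : N) (X : 'rV[R]_n) : 'rV[R]_n :=
  X *m 'J (chart p \o ichart q) (chart q q).

Definition field_rep {n} {N : manifold R n} (V : N -> 'rV[R]_n) (p : N)
    (y : 'rV[R]_n) : 'rV[R]_n :=
  tcoord p (ichart p y) (V (ichart p y)).

Definition smooth_vector_field {n} {N : manifold R n} (V : N -> 'rV[R]_n) :=
  forall p, smooth_on (ccod p) (field_rep V p).

(* [w] is the velocity at time [t] of the curve [c] defined on [I]; at an end
   point of an interval [I] this is a one-sided derivative. *)
Definition velocity {n} {N : manifold R n} (I : set R) (c : R -> N) (t : R)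
    (w : 'rV[R]_n) : Prop :=
  c @ within I (nbhs t) --> c t /\
  (fun s => (s - t)^-1 *: (chart (c t) (c s) - chart (c t) (c t)))
    @ within I t^' --> w.

Definition generated_by {n} {N : manifold R n} (phi : R -> N -> N)
    (V : N -> 'rV[R]_n) : Prop :=
  (forall y, phi 0 y = y) /\
  forall t y, velocity setT (phi ^~ y) t (V (phi t y)).

End Maps.

Section RiemannianGeometry.
Context {R : realType}.

(* A metric is given at each point [p] by its Gram matrix in [chart p]. *)
Definition inner {n} {N : manifold R n} (h : N -> 'M[R]_n) (p : N)
    (X Y : 'rV[R]_n) : R := (X *m h p *m Y^T) 0 0.

(* Gram matrix at the point of coordinates [y] in [chart p]; row [i] of [B] is
   the [i]-th coordinate field of [chart p], as an element of T_(ichart p y). *)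
Definition metric_rep {n} {N : manifold R n} (h : N -> 'M[R]_n) (p : N)
    (y : 'rV[R]_n) : 'M[R]_n :=
  let B := 'J (chart (ichart p y) \o ichart p) y in
  B *m h (ichart p y) *m B^T.

Definition riemannian_metric {n} {N : manifold R n} (h : N -> 'M[R]_n) : Prop :=
  [/\ forall p, (h p)^T = h p,
      forall p X, X != 0 -> 0 < inner h p X X &
      forall p, smooth_on (ccod p) (metric_rep h p)].

Definition isometry {m n} {M : manifold R m} {N : manifold R n}
    (g : M -> 'M[R]_m) (h : N -> 'M[R]_n) (f : M -> N) : Prop :=
  diffeomorphism f /\
  forall x X Y, inner h (f x) (X *m dmap f x) (Y *m dmap f x) = inner g x X Y.

Definition isometry_group {n} {N : manifold R n} (h : N -> 'M[R]_n)
    (phi : R -> N -> N) : Prop :=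
  [/\ smooth_family setT phi,
      forall y, phi 0 y = y,
      forall s t y, phi (s + t) y = phi s (phi t y) &
      forall t, isometry h h (phi t)].

(* Vanishing of the Lie derivative of the metric,
   V^k d_k h_ij + (d_i V^k) h_kj + h_ik (d_j V^k) = 0. *)
Definition killing_field {n} {N : manifold R n} (h : N -> 'M[R]_n)
    (V : N -> 'rV[R]_n) : Prop :=
  smooth_vector_field V /\
  forall p y, ccod p y ->
    let A := 'J (field_rep V p) y *m metric_rep h p y in
    'D_(field_rep V p y) (metric_rep h p) y + A + A^T = 0.

(* [christoffel h p y i j] is the vector of components Gamma^k_ij, k < n, of
   the Levi-Civita connection in [chart p], at the point of coordinates [y]. *)
Definition christoffel {n} {N : manifold R n} (h : N -> 'M[R]_n) (p : N)
    (y : 'rV[R]_n) (i j : 'I_n) : 'rV[R]_n :=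
  let d (a b c : 'I_n) : R :=
    'D_(basis_vec a) (fun z : 'rV[R]_n => metric_rep h p z b c) y in
  \row_k (2^-1 * \sum_l invmx (metric_rep h p y) k l
                         * (d i j l + d j i l - d l i j)).

(* Gamma(X, Y) at the centre of the chart [chart p] *)
Definition christoffel_form {n} {N : manifold R n} (h : N -> 'M[R]_n) (p : N)
    (X Y : 'rV[R]_n) : 'rV[R]_n :=
  \sum_b \sum_c (X 0 b * Y 0 c) *: christoffel h p (chart p p) b c.

(* R(X, Y) Z = nabla_X nabla_Y Z - nabla_Y nabla_X Z - nabla_[X, Y] Z *)
Definition curvature {n} {N : manifold R n} (h : N -> 'M[R]_n) (p : N)
    (X Y Z : 'rV[R]_n) : 'rV[R]_n :=
  let y := chart p p in
  let G := christoffel h p in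
  let Rm (i j k : 'I_n) : 'rV[R]_n :=
    'D_(basis_vec i) (fun z : 'rV[R]_n => G z j k) y
    - 'D_(basis_vec j) (fun z : 'rV[R]_n => G z i k) y
    + \sum_l G y j k 0 l *: G y i l - \sum_l G y i k 0 l *: G y j l in
  \sum_i \sum_j \sum_k (X 0 i * Y 0 j * Z 0 k) *: Rm i j k.

(* (nabla du)(d_i, d_j), in the chart at [x], as an element of T_(u x) N *)
Definition nabla_du {m n} {M : manifold R m} {N : manifold R n}
    (g : M -> 'M[R]_m) (h : N -> 'M[R]_n) (u : M -> N) (x : M)
    (i j : 'I_m) : 'rV[R]_n :=
  let f := chart (u x) \o u \o ichart x in
  let y := chart x x in
  'D_(basis_vec i) ('D_(basis_vec j) f) y
  - \sum_k christoffel g x y i j 0 k *: 'D_(basis_vec k) f y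
  + christoffel_form h (u x) ('D_(basis_vec i) f y) ('D_(basis_vec j) f y).

Definition tension {m n} {M : manifold R m} {N : manifold R n}
    (g : M -> 'M[R]_m) (h : N -> 'M[R]_n) (u : M -> N) (x : M) : 'rV[R]_n :=
  \sum_i \sum_j invmx (g x) i j *: nabla_du g h u x i j.

(* du(E), as a section of u^*TN *)
Definition du_along {m n} {M : manifold R m} {N : manifold R n}
    (u : M -> N) (E : M -> 'rV[R]_m) (x : M) : 'rV[R]_n := E x *m dmap u x.

(* nabla_E X for a section [X] of u^*TN and the connection on u^*TN induced by
   the Levi-Civita connection of [h].  The values of [X] near [x] are first
   expressed in the single chart [chart (u x)] of [N]. *)
Definition cov_along {m n} {M : manifold R m} {N : manifold R n}
    (h : N -> 'M[R]_n) (u : M -> N) (E : M -> 'rV[R]_m) (X : M -> 'rV[R]_n)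
    (x : M) : 'rV[R]_n :=
  'D_(E x) (fun y : 'rV[R]_m =>
              tcoord (u x) (u (ichart x y)) (X (ichart x y))) (chart x x)
  + christoffel_form h (u x) (du_along u E x) (X x).

End RiemannianGeometry.

Section KaehlerGeometry.
Context {R : realType}.

(* Multiplication by i on C^k, where [row_mx a b] stands for a + i b. *)
Definition Jmx (k : nat) : 'M[R]_(k + k) := block_mx 0 1%:M (- 1%:M) 0.

Definition cplxJ {k} (X : 'rV[R]_(k + k)) : 'rV[R]_(k + k) := X *m Jmx k.

(* The charts take values in C^k and their transition maps are holomorphic
   (Cauchy-Riemann equations).  The complex structure of [N] is then [cplxJ] on
   every tangent space, and it has matrix [Jmx k] in every chart. *)
Definition complex_atlas {k} (N : manifold R (k + k)) : Prop :=
  forall (p q : N) y, ccod p y -> cdom q (ichart p y) ->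
    let A := 'J (chart q \o ichart p) y in Jmx k *m A = A *m Jmx k.

(* Matrix in [chart p] of the 2-form omega(X, Y) = h(JX, Y). *)
Definition kaehler_form {k} {N : manifold R (k + k)} (h : N -> 'M[R]_(k + k))
    (p : N) (y : 'rV[R]_(k + k)) : 'M[R]_(k + k) :=
  Jmx k *m metric_rep h p y.

Definition kaehler_metric {k} {N : manifold R (k + k)}
    (h : N -> 'M[R]_(k + k)) : Prop :=
  [/\ riemannian_metric h,
      forall p X Y, inner h p (cplxJ X) (cplxJ Y) = inner h p X Y &
      (* closedness of the fundamental form *)
      forall (p : N) y, ccod p y -> forall a b c,
        let d (i j l : 'I_(k + k)) : R :=
          'D_(basis_vec i)
             (fun z : 'rV[R]_(k + k) => kaehler_form h p z j l) y in
        d a b c + d b c a + d c a b = 0].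

Definition holomorphic_flow {k} {N : manifold R (k + k)}
    (phi : R -> N -> N) : Prop :=
  forall t y X, cplxJ (X *m dmap (phi t) y) = cplxJ X *m dmap (phi t) y.

(* [E] is the vector field d/dx of the arc-length coordinate. *)
Definition tau2 {m k} {M : manifold R m} {N : manifold R (k + k)}
    (h : N -> 'M[R]_(k + k)) (E : M -> 'rV[R]_m) (u : M -> N) (x : M)
    : 'rV[R]_(k + k) :=
  let ux := du_along u E in
  - cplxJ (cov_along h u E (cov_along h u E ux) x)
  + 2^-1 *: curvature h (u x) (ux x) (cplxJ (ux x)) (ux x).

(* On a 1-dimensional manifold, an arc-length coordinate x is local (it may
   even be multi-valued, as on a circle), but d/dx is a globally defined unit
   field; conversely a smooth unit field is d/dx for such a coordinate. *)
Definition arclength_field {m} {M : manifold R m} (g : M -> 'M[R]_m)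
    (E : M -> 'rV[R]_m) : Prop :=
  smooth_vector_field E /\ forall x, inner g x (E x) (E x) = 1.

(* Diffeomorphism with a subset [S] of R^d, smoothness on [S] being understood
   in the sense of local extensions. *)
Definition diffeomorphic_to_subset {m} (M : manifold R m) {d}
    (S : set 'rV[R]_d) : Prop :=
  exists (f : M -> 'rV[R]_d) (f' : 'rV[R]_d -> M),
    [/\ forall x, S (f x), cancel f f' & forall z, S z -> f (f' z) = z] /\
    [/\ forall p, smooth_on (ccod p) (f \o ichart p),
        {within S, continuous f'} &
        forall q, smooth_on (S `&` f' @^-1` cdom q) (chart q \o f')].

Definition unit_circle : set 'rV[R]_2 :=
  [set z | z 0 0 ^+ 2 + z 0 1 ^+ 2 = 1].

Definition line_or_circle {m} (M : manifold R m) : Prop :=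
  diffeomorphic_to_subset M [set: 'rV[R]_1] \/
  diffeomorphic_to_subset M unit_circle.

(* [u : I * M -> N] solves u_t = J(u) tau(u); the values of [u] outside [I] are
   irrelevant. *)
Definition flow_solution {m k} {M : manifold R m} {N : manifold R (k + k)}
    (tau : (M -> N) -> M -> 'rV[R]_(k + k)) (I : set R) (u : R -> M -> N)
    : Prop :=
  smooth_family I u /\
  forall t x, I t -> velocity I (u ^~ x) t (cplxJ (tau (u t) x)).

Definition geometric_soliton {m k} {M : manifold R m} {N : manifold R (k + k)}
    (g : M -> 'M[R]_m) (h : N -> 'M[R]_(k + k))
    (tau : (M -> N) -> M -> 'rV[R]_(k + k)) (I : set R) (u : R -> M -> N)
    : Prop :=
  flow_solution tau I u /\
  exists (psi : R -> M -> M) (phi : R -> N -> N) (v : M -> N),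
    [/\ isometry_group g psi, isometry_group h phi &
        forall t x, I t -> u t x = phi t (v (psi t x))].

End KaehlerGeometry.

(* Main.v *)
(* Differentiating u(t, x) = phi_t(v(psi_t(x))) in t gives
   u_t = dphi_t(V(v) + dv(W)) at the point psi_t(x), because V is invariant
   under its own flow.  On the other hand tau_1 and tau_2 are natural under
   isometries, so tau(u) = dphi_t(tau(v)) at psi_t(x), and J commutes with
   dphi_t.  Hence the flow equation at time t is the image under dphi_t of the
   stationary equation for v, and at t = 0 it is that equation.

   Naturality is checked in charts, where isometries and changes of charts are
   alike: both are local isometries F between Gram matrices, whose second
   derivative is D_X D_Y F = dF(Gamma(X, Y)) - Gamma'(dF X, dF Y).  For tau_2,
   psi_t must also preserve the unit field d/dx: it does so up to a sign, which
   is continuous in t and equal to 1 at t = 0. *)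

Require Import Defs.
From HB Require Import structures.
From mathcomp Require Import all_boot all_order all_algebra.
From mathcomp Require Import all_classical all_reals all_analysis.
From mathcomp Require Import ring lra.
Import Order.TTheory GRing.Theory Num.Theory.
Import numFieldNormedType.Exports.
Set Implicit Arguments.
Unset Strict Implicit.
Unset Printing Implicit Defensive.
Local Open Scope classical_set_scope.
Local Open Scope ring_scope.

(** * Calculus of smooth maps between Euclidean spaces *)

(** Charts are total functions with arbitrary values outside their domains, so a coordinate
    expression means something only as a germ: smoothness is handled pointwise by [smooth_at], and
    equality of maps as equality near a point. A section of u^*TN records each value in the
    preferred chart of its own base point, so its values near x must be moved to one chart before
    they can be differentiated. Iterating the covariant derivative, as tau_2 demands, also requires
    knowing that the outcome does not depend on that chart. [covrep_natural] gives this and the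
    naturality under isometries at once, a change of charts being the case of identity maps. The
    second-derivative law of a local isometry rests on the Koszul identity and the symmetry of mixed
    derivatives; the invariance of curvature comes from differentiating that law once more. The time
    interval has 0 as an end point, so velocities there are one-sided; their uniqueness at 0, which
    uses T > 0, is what extracts the stationary equation from the flow. *)

Section Germs.
Context {R : realType} {V W : normedModType R}.

Lemma near_eq_derive_near (f g : V -> W) (x v : V) :
  (\forall y \near x, f y = g y) -> \forall y \near x, 'D_v f y = 'D_v g y.
Proof.
move=> /near_join fg; near=> y; apply: near_eq_derive; near: y; exact: fg.
Unshelve. all: by end_near. Qed.

(** Write g = f + (g - f): the germ of g - f vanishes, so g - f has differential 0 with zero
    remainder. *)
Lemma near_eq_differentiable (f g : V -> W) (x : V) :
  (\forall y \near x, f y = g y) -> differentiable f x -> differentiable g x.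
Proof.
move=> fg df.
suff d0 : differentiable (g - f) x.
  have -> : g = f + (g - f) by rewrite addrC subrK.
  exact: differentiableD.
have E : (g - f) \o shift x = cst ((g - f) x) + \0 +o_ 0 id.
  apply/eqaddoP => _/posnumP[e].
  have : \forall y \near 0, f (y + x) = g (y + x).
    move: fg; rewrite (near_shift 0); apply: filterS => y /=.
    by rewrite subr0.
  apply: filterS => y fgy.
  rewrite -![(_ - _ : _ -> _) _]/(_ - _) /= /shift /=.
  rewrite -![(_ - _ : _ -> _) _]/(_ - _) -![(_ + _ : _ -> _) _]/(_ + _) /cst.
  by rewrite fgy (nbhs_singleton fg) /= !subrr addr0 subr0 normr0 mulr_ge0.
have c0 : continuous (\0 : V -> W) by exact: cst_continuous.
apply/diff_locallyP; rewrite (diff_unique (df := \0) c0 E); split => //.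
Qed.

Lemma is_derive_line (f : V -> W) (a v : V) (s : R) :
  differentiable f (a + s *: v) ->
  is_derive s 1 (fun r => f (a + r *: v)) ('D_v f (a + s *: v)).
Proof.
have E : (fun h : R => h^-1 *: (((fun r => f (a + r *: v)) \o shift s) (h *: 1)
             - f (a + s *: v))) =
  (fun h => h^-1 *: ((f \o shift (a + s *: v)) (h *: v) - f (a + s *: v))).
  apply/funext => h /=; congr (_ *: (f _ - _)).
  by rewrite [h *: 1]mulr1 scalerDl addrCA.
move=> /diff_derivable d.
split; rewrite ?/derivable ?/derive [X in X @ _]E; [exact: d|by []].
Qed.

End Germs.

(** * Algebra of maps of class C^k on an open set *)

Section CkTheory.
Context {R : realType} {m : nat}.
Implicit Types (O : set 'rV[R]_m).

Section AnyTarget.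
Context {W : normedModType R}.
Implicit Types (f g : 'rV[R]_m -> W).

Lemma CkW k O O' f : O' `<=` O -> Ck k O f -> Ck k O' f.
Proof.
move=> OO; elim: k f => [|k IH] f /=.
  by move=> H x /OO /H.
by move=> [df H]; split => [x /OO /df //|i]; exact: IH.
Qed.

(** Openness of [O] turns agreement on [O] into agreement of germs, which is all that derivatives
    see. *)
Lemma Ck_eq k O f g : open O -> (forall x, O x -> f x = g x) ->
  Ck k O f -> Ck k O g.
Proof.
move=> oO; elim: k f g => [|k IH] f g fg /=.
  move=> H x Ox; suff : g @ x --> g x by [].
  have n : \forall y \near x, f y = g y by apply: filterS fg (open_nbhs_nbhs _).
  rewrite -(fg x Ox); apply: cvg_trans (H x Ox); exact: (near_eq_cvg n).
have nfg x : O x -> \forall y \near x, f y = g y.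
  by move=> Ox; apply: filterS fg (open_nbhs_nbhs _).
move=> [df H]; split=> [x Ox|i].
  exact: near_eq_differentiable (nfg x Ox) (df x Ox).
apply: IH (H i) => x Ox; apply: near_eq_derive; exact: nfg.
Qed.

Lemma CkS k O f : Ck k.+1 O f -> Ck k O f.
Proof.
elim: k f => [|k IH] f [df H] /=.
  by move=> x Ox; apply: differentiable_continuous; exact: df.
by split => // i; exact: IH.
Qed.

Lemma Ck_cst k O (w : W) : Ck k O (fun=> w).
Proof.
elim: k w => [|k IH] w /=; first by move=> x _; exact: cst_continuous.
split => [x _ | i]; first exact: differentiable_cst.
have -> : 'D_(basis_vec i) (fun=> w) = (fun=> 0 : W).
  by apply/funext => x; exact: derive_cst.
exact: IH.
Qed.

Lemma CkD k O f g : open O -> Ck k O f -> Ck k O g ->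
  Ck k O (fun x => f x + g x).
Proof.
move=> oO; elim: k f g => [|k IH] f g /=.
  by move=> cf cg x Ox; apply: continuousD; [exact: cf|exact: cg].
move=> [df Hf] [dg Hg]; split=> [x Ox|i].
  exact: (@differentiableD _ _ _ f g x (df x Ox) (dg x Ox)).
apply: Ck_eq (IH _ _ (Hf i) (Hg i)) => // x Ox.
by rewrite (@deriveD _ _ _ f g) //; apply: diff_derivable; [exact: df|exact: dg].
Qed.

Lemma Ck_sum (I : Type) (r : seq I) (P : pred I) k O
    (F : I -> 'rV[R]_m -> W) : open O ->
  (forall i, P i -> Ck k O (F i)) -> Ck k O (fun x => \sum_(i <- r | P i) F i x).
Proof.
move=> oO H; elim: r => [|j r IH].
  by apply: Ck_eq (Ck_cst k O 0) => // x _; rewrite big_nil.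
case Pj: (P j).
  by apply: Ck_eq (CkD oO (H j Pj) IH) => // x _; rewrite big_cons Pj.
by apply: Ck_eq IH => // x _; rewrite big_cons Pj.
Qed.

Lemma CkZl k O (f : 'rV[R]_m -> R) (w : W) : open O ->
  Ck k O f -> Ck k O (fun x => f x *: w).
Proof.
move=> oO; elim: k f => [|k IH] f /=.
  move=> cf x Ox; apply: (@continuous_comp _ _ _ f (fun r => r *: w)); first exact: cf.
  exact: scalel_continuous.
move=> [df H]; split => [x Ox|i]; first exact: differentiableZl (df x Ox).
apply: Ck_eq (IH _ (H i)) => // x Ox.
rewrite [RHS]deriveE ?diffZl //; last exact: differentiableZl (df x Ox).
- by rewrite deriveE //; exact: df.
- exact: df.
Qed.

End AnyTarget.

Lemma CkM k O (f g : 'rV[R]_m -> R) : open O -> Ck k O f -> Ck k O g ->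
  Ck k O (fun x => f x * g x).
Proof.
move=> oO; elim: k f g => [|k IH] f g.
  by move=> cf cg x Ox; apply: (@continuousM _ _ f g); [exact: cf|exact: cg].
move=> Hf Hg; have [df Hf'] := Hf; have [dg Hg'] := Hg; split => [x Ox|i].
  exact: (@differentiableM _ _ f g x (df x Ox) (dg x Ox)).
apply: Ck_eq (CkD oO (IH _ _ (CkS Hf) (Hg' i)) (IH _ _ (CkS Hg) (Hf' i))) => //.
move=> x Ox.
by rewrite (@deriveM _ _ f g) //; apply: diff_derivable; [exact: df|exact: dg].
Qed.

(** Induction on [k] through (1/f)' = -(1/f)(1/f)f', where the induction hypothesis makes the
    factors 1/f of class C^k. *)
Lemma Ck_inv k O (f : 'rV[R]_m -> R) : open O -> (forall x, O x -> f x != 0) ->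
  Ck k O f -> Ck k O (fun x => (f x)^-1).
Proof.
move=> oO f0; elim: k => [|k IH].
  by move=> cf x Ox; apply: continuousV; [exact: f0|exact: cf].
move=> Hf; have [df Hf'] := Hf; split => [x Ox|i].
  exact: (@differentiableV _ _ f x (df x Ox) (f0 x Ox)).
have Hi := IH (CkS Hf).
have H1 := CkM oO (CkM oO Hi Hi) (Hf' i).
have H2 := CkM oO (@Ck_cst R k O (-1)) H1.
apply: Ck_eq H2 => // x Ox.
rewrite (@deriveV _ _ f x _ (f0 x Ox)); last exact: diff_derivable (df x Ox).
rewrite mulN1r -[RHS]/(- _ * _) mulNr; congr (- (_ * _)).
by rewrite expr2 invfM.
Qed.

Lemma Ck_mx k O p q (A : 'rV[R]_m -> 'M[R]_(p, q)) : open O ->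
  (forall i j, Ck k O (fun x => A x i j)) -> Ck k O A.
Proof.
move=> oO H.
have S : Ck k O (fun x => \sum_i \sum_j A x i j *: (delta_mx i j : 'M[R]_(p, q))).
  by apply: Ck_sum => // i _; apply: Ck_sum => // j _; exact: CkZl.
by apply: Ck_eq S => // x _; rewrite -matrix_sum_delta.
Qed.

Lemma differentiable_mx p q (A : 'rV[R]_m -> 'M[R]_(p, q)) x :
  (forall i j, differentiable (fun x => A x i j) x) <-> differentiable A x.
Proof.
split => [H|dA i j]; last first.
  exact: (@differentiable_comp _ _ _ _ A (fun N : 'M[R]_(p, q) => N i j : R) x dA
           (differentiable_coord _ i j)).
have -> : A = \sum_i \sum_j (fun x => A x i j *: (delta_mx i j : 'M[R]_(p, q))).
  apply/funext => y; rewrite [LHS]matrix_sum_delta fct_sumE.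
  by apply: eq_bigr => i _; rewrite fct_sumE.
do 2![apply: differentiable_sum => ?]; exact: differentiableZl.
Qed.

Lemma derive_coord p q (A : 'rV[R]_m -> 'M[R]_(p, q)) x v i j :
  differentiable A x -> ('D_v A x) i j = 'D_v (fun y => A y i j) x.
Proof. by move=> dA; rewrite derive_mx ?mxE //; exact: diff_derivable. Qed.

Lemma Ck_coord k O p q (A : 'rV[R]_m -> 'M[R]_(p, q)) i j : open O ->
  Ck k O A -> Ck k O (fun x => A x i j).
Proof.
move=> oO; elim: k A => [|k IH] A.
  move=> cA x Ox; apply: (@continuous_comp _ _ _ A (fun N : 'M[R]_(p, q) => N i j)).
    exact: cA.
  exact: coord_continuous.
move=> [dA H]; split => [x Ox|l].
  exact: (differentiable_mx A x).2 (dA x Ox) i j.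
by apply: Ck_eq (IH _ (H l)) => // x Ox; rewrite derive_coord //; exact: dA.
Qed.

End CkTheory.

Lemma derive_comp {R : realType} {m n} {W : normedModType R} (f : 'rV[R]_m -> 'rV[R]_n)
    (g : 'rV[R]_n -> W) x v :
  differentiable f x -> differentiable g (f x) ->
  'D_v (g \o f) x = 'D_('D_v f x) g (f x).
Proof.
move=> df dg.
rewrite (deriveE v (differentiable_comp df dg)) (diff_comp df dg) /=.
by rewrite (deriveE v df) (deriveE _ dg).
Qed.

Lemma derive_basis {R : realType} {m} {W : normedModType R} (f : 'rV[R]_m -> W) x v :
  differentiable f x -> 'D_v f x = \sum_i v 0 i *: 'D_(basis_vec i) f x.
Proof.
move=> df; rewrite deriveE // [in LHS](row_sum_delta v) linear_sum.
by apply: eq_bigr => i _; rewrite linearZ deriveE.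
Qed.

(** Coordinates reduce to scalar [g]. There the chain rule writes a partial derivative of g o f as a
    sum of products of D_i f_j with D_j g o f, and the latter falls under the induction hypothesis
    on [k]. *)
Lemma Ck_comp {R : realType} {m n p q} k (O : set 'rV[R]_m) (O' : set 'rV[R]_n)
   (f : 'rV[R]_m -> 'rV[R]_n) (g : 'rV[R]_n -> 'M[R]_(p, q)) :
  open O -> open O' -> (forall x, O x -> O' (f x)) ->
  Ck k O f -> Ck k O' g -> Ck k O (g \o f).
Proof.
move=> oO oO' fO.
suff H : forall g : 'rV[R]_n -> R, Ck k O f -> Ck k O' g -> Ck k O (g \o f).
  by move=> Hf Hg; apply: Ck_mx => // i j; apply: (H (fun y => g y i j)) => //; exact: Ck_coord.
elim: k => [|k IH] {}g.
  move=> cf cg x Ox; apply: continuous_comp; first exact: cf.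
  by apply: cg; exact: fO.
move=> Hf Hg; have [df Hf'] := Hf; have [dg Hg'] := Hg; split => [x Ox|i].
  by apply: differentiable_comp; [exact: df|apply: dg; exact: fO].
have S : Ck k O (fun x => \sum_j ('D_(basis_vec i) f x) 0 j * 'D_(basis_vec j) g (f x)).
  apply: Ck_sum => // j _; apply: CkM => //.
    by apply: Ck_coord => //; exact: Hf'.
  exact: (IH _ (CkS Hf) (Hg' j)).
apply: Ck_eq S => // x Ox.
by rewrite (derive_comp _ (df x Ox) (dg _ (fO x Ox))) (derive_basis _ (dg _ (fO x Ox))).
Qed.

(** A single neighbourhood serves every order [k], which makes this an open condition on the point
    that is stable under differentiation. *)
Definition smooth_at {R : realType} {m} {W : normedModType R}
    (f : 'rV[R]_m -> W) (x : 'rV[R]_m) : Prop :=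
  exists2 O : set 'rV[R]_m, open_nbhs x O & forall k, Ck k O f.

Lemma near_open {T : topologicalType} (x : T) (P : set T) :
  (\forall y \near x, P y) -> exists2 O, open_nbhs x O & O `<=` P.
Proof. by move=> H; have : nbhs x P := H; rewrite nbhsE. Qed.

Lemma near_conj {T : topologicalType} (x : T) (P Q : T -> Prop) :
  (\forall y \near x, P y) -> (\forall y \near x, Q y) ->
  \forall y \near x, P y /\ Q y.
Proof. by move=> HP HQ; apply: filterI. Qed.

(** * Calculus of maps smooth near a point *)

Section SmoothAt.
Context {R : realType} {m : nat}.
Implicit Types (x v w : 'rV[R]_m).

Section AnyTarget.
Context {W : normedModType R}.
Implicit Types (f g : 'rV[R]_m -> W).

Lemma smooth_at_near f x : smooth_at f x -> \forall y \near x, smooth_at f y.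
Proof.
move=> [ O [oO Ox] H].
by apply: filterS (open_nbhs_nbhs (conj oO Ox)) => y Oy; exists O.
Qed.

Lemma smooth_at_diff f x : smooth_at f x -> differentiable f x.
Proof. by move=> [ O [oO Ox] /(_ 1%N) [df _]]; exact: df. Qed.

Lemma smooth_at_continuous f x : smooth_at f x -> {for x, continuous f}.
Proof. by move=> /smooth_at_diff/differentiable_continuous. Qed.

Lemma smooth_at_eq f g x : (\forall y \near x, f y = g y) ->
  smooth_at f x -> smooth_at g x.
Proof.
move=> /near_open [ O' [oO' O'x] fg] [ O [oO Ox] H].
have oI : open (O `&` O') by exact: openI.
exists (O `&` O') => // k.
apply: (Ck_eq (f := f)) => // [y [_ /fg] //|].
by apply: (CkW (O := O)) => // y [].
Qed.

Lemma smooth_at_cst (c : W) x : smooth_at (fun=> c) x.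
Proof.
exists setT => [|k]; last exact: Ck_cst.
by split => //; exact: openT.
Qed.

Lemma smooth_atD f g x : smooth_at f x -> smooth_at g x ->
  smooth_at (fun y => f y + g y) x.
Proof.
move=> [ O [oO Ox] Hf] [ O' [oO' O'x] Hg].
have oI : open (O `&` O') by exact: openI.
exists (O `&` O') => // k; apply: CkD => //.
  by apply: CkW (Hf k) => y [].
by apply: CkW (Hg k) => y [].
Qed.

Lemma smooth_at_sum (I : Type) (r : seq I) (P : pred I)
    (F : I -> 'rV[R]_m -> W) x :
  (forall i, P i -> smooth_at (F i) x) ->
  smooth_at (fun y => \sum_(i <- r | P i) F i y) x.
Proof.
move=> H; elim: r => [|j r IH].
  apply: smooth_at_eq (smooth_at_cst 0 x).
  by near=> y; rewrite big_nil.
case Pj: (P j).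
  apply: smooth_at_eq (smooth_atD (H j Pj) IH).
  by near=> y; rewrite big_cons Pj.
apply: smooth_at_eq IH.
by near=> y; rewrite big_cons Pj.
Unshelve. all: by end_near. Qed.

Lemma smooth_atZl (f : 'rV[R]_m -> R) (w : W) x :
  smooth_at f x -> smooth_at (fun x => f x *: w) x.
Proof. by move=> [ O [oO Ox] H]; exists O => // k; exact: CkZl. Qed.

Lemma CkZr k (O : set 'rV[R]_m) (c : R) f : open O ->
  Ck k O f -> Ck k O (fun x => c *: f x).
Proof.
move=> oO; elim: k f => [|k IH] f.
  by move=> cf x Ox; apply: (@continuousZl_tmp _ _ _ f c x); exact: cf.
move=> [df Hf]; split => [x Ox|j]; first exact: differentiableZ (df x Ox).
apply: Ck_eq (IH _ (Hf j)) => // x Ox.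
by rewrite [RHS]deriveZ //; apply: diff_derivable; exact: df.
Qed.

Lemma derive_addr f x v w : differentiable f x ->
  'D_(v + w) f x = 'D_v f x + 'D_w f x.
Proof. by move=> df; rewrite !deriveE // linearD. Qed.

Lemma derive_subr f x v w : differentiable f x ->
  'D_(v - w) f x = 'D_v f x - 'D_w f x.
Proof. by move=> df; rewrite !deriveE // linearB. Qed.

(** [Ck] speaks of partial derivatives only; a derivative in direction [v] is, near x, their
    combination with the coordinates of [v]. *)
Lemma smooth_at_deriv f x v : smooth_at f x -> smooth_at ('D_v f) x.
Proof.
move=> sf.
suff S : smooth_at (fun y => \sum_i v 0 i *: 'D_(basis_vec i) f y) x.
  apply: smooth_at_eq S.
  have := smooth_at_near sf; apply: filterS => y /smooth_at_diff df.
  by rewrite [RHS]derive_basis.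
apply: smooth_at_sum => i _.
have [ O [oO Ox] Hf] := sf; exists O => // k.
apply: CkZr => //; have [_] := Hf k.+1; exact.
Qed.

End AnyTarget.

Lemma smooth_atM (f g : 'rV[R]_m -> R) x : smooth_at f x -> smooth_at g x ->
  smooth_at (fun y => f y * g y) x.
Proof.
move=> [ O [oO Ox] Hf] [ O' [oO' O'x] Hg].
have oI : open (O `&` O') by exact: openI.
exists (O `&` O') => // k; apply: CkM => //.
  by apply: CkW (Hf k) => y [].
by apply: CkW (Hg k) => y [].
Qed.

Lemma smooth_at_prod (I : Type) (r : seq I) (P : pred I)
    (F : I -> 'rV[R]_m -> R) x :
  (forall i, P i -> smooth_at (F i) x) ->
  smooth_at (fun y => \prod_(i <- r | P i) F i y) x.
Proof.
move=> H; elim: r => [|j r IH].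
  apply: smooth_at_eq (smooth_at_cst (1 : R) x).
  by near=> y; rewrite big_nil.
case Pj: (P j).
  apply: smooth_at_eq (smooth_atM (H j Pj) IH).
  by near=> y; rewrite big_cons Pj.
apply: smooth_at_eq IH.
by near=> y; rewrite big_cons Pj.
Unshelve. all: by end_near. Qed.

Lemma smooth_at_inv (f : 'rV[R]_m -> R) x : f x != 0 -> smooth_at f x ->
  smooth_at (fun y => (f y)^-1) x.
Proof.
move=> fx0 sf.
have : \forall y \near x, f y != 0.
  have /cvgr_neq0 := smooth_at_continuous sf.
  exact.
have [ O [oO Ox] Hf] := sf.
move=> /near_open [ O' [oO' O'x] f0].
have oI : open (O `&` O') by exact: openI.
exists (O `&` O') => // k; apply: Ck_inv => //; first by move=> y [_ /f0].
by apply: CkW (Hf k) => y [].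
Qed.

Section Matrices.
Context {p q : nat}.
Implicit Types (A B : 'rV[R]_m -> 'M[R]_(p, q)).

Lemma smooth_at_coord A x i j : smooth_at A x -> smooth_at (fun y => A y i j) x.
Proof. by move=> [ O [oO Ox] H]; exists O => // k; exact: Ck_coord. Qed.

Lemma smooth_at_mx A x :
  (forall i j, smooth_at (fun y => A y i j) x) -> smooth_at A x.
Proof.
move=> H.
have S : smooth_at
    (fun x => \sum_i \sum_j A x i j *: (delta_mx i j : 'M[R]_(p, q))) x.
  by apply: smooth_at_sum => i _; apply: smooth_at_sum => j _; exact: smooth_atZl.
by apply: smooth_at_eq S; near=> y; rewrite -matrix_sum_delta.
Unshelve. all: by end_near. Qed.

Lemma smooth_atZ (f : 'rV[R]_m -> R) A x : smooth_at f x -> smooth_at A x ->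
  smooth_at (fun y => f y *: A y) x.
Proof.
move=> sf sA; apply: smooth_at_mx => i j.
apply: smooth_at_eq (smooth_atM sf (smooth_at_coord i j sA)).
by near=> y; rewrite !mxE.
Unshelve. all: by end_near. Qed.

End Matrices.

Lemma smooth_at_mulmx {p q r} (A : 'rV[R]_m -> 'M[R]_(p, q)) (B : 'rV[R]_m -> 'M[R]_(q, r)) x :
  smooth_at A x -> smooth_at B x -> smooth_at (fun y => A y *m B y) x.
Proof.
move=> sA sB; apply: smooth_at_mx => i j.
have S : smooth_at (fun y => \sum_k A y i k * B y k j) x.
  by apply: smooth_at_sum => k _; apply: smooth_atM; exact: smooth_at_coord.
by apply: smooth_at_eq S; near=> y; rewrite mxE.
Unshelve. all: by end_near. Qed.

Lemma smooth_at_trmx {p q} (A : 'rV[R]_m -> 'M[R]_(p, q)) x : smooth_at A x -> smooth_at (fun y => (A y)^T) x.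
Proof.
move=> sA; apply: smooth_at_mx => i j.
by apply: smooth_at_eq (smooth_at_coord j i sA); near=> y; rewrite mxE.
Unshelve. all: by end_near. Qed.

Lemma derive_mulmx {p q r} (A : 'rV[R]_m -> 'M[R]_(p, q)) (B : 'rV[R]_m -> 'M[R]_(q, r)) x v :
  differentiable A x -> differentiable B x ->
  'D_v (fun y => A y *m B y) x = 'D_v A x *m B x + A x *m 'D_v B x.
Proof.
move=> dA dB; have cA := differentiable_mx A x; have cB := differentiable_mx B x.
have dM i k j : differentiable (fun y => A y i k * B y k j) x.
  apply: (@differentiableM _ _ (fun y => A y i k) (fun y => B y k j)).
  - exact: cA.2.
  - exact: cB.2.
have E : (fun y => A y *m B y) = fun y => \matrix_(i, j) \sum_k (A y i k * B y k j).
  by apply/funext => y; apply/matrixP => i j; rewrite !mxE.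
have dS i j : derivable (fun y => \sum_k A y i k * B y k j) x v.
  have := @derivable_sum _ _ _ _ (fun k y => A y i k * B y k j) x v.
  rewrite fct_sumE; apply => k; apply: diff_derivable; exact: dM.
have dAB : derivable (fun y => A y *m B y) x v.
  apply/derivable_mxP => i j; have := dS i j; apply: near_eq_derivable.
  by near=> y; rewrite mxE.
rewrite derive_mx //; apply/matrixP => i j; rewrite !mxE.
rewrite (_ : (fun y => (A y *m B y) i j) = \sum_k (fun y => A y i k * B y k j)); last first.
  by apply/funext => y; rewrite mxE fct_sumE.
rewrite derive_sum; last by move=> k; exact: diff_derivable.
rewrite -big_split; apply: eq_bigr => k _ /=.
rewrite (@deriveM _ _ (fun y => A y i k) (fun y => B y k j)).
- rewrite addrC !derive_coord //; congr (_ + _); exact: mulrC.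
- apply: diff_derivable; exact: cA.2.
- apply: diff_derivable; exact: cB.2.
Unshelve. all: by end_near. Qed.

Lemma smooth_at_id x : smooth_at (fun y : 'rV[R]_m => y) x.
Proof.
apply: smooth_at_mx => i j; exists setT => [|k]; first by split => //; exact: openT.
case: k => [|k] /=; first by move=> y _; exact: coord_continuous.
split => [y _|l]; first exact: differentiable_coord.
apply: Ck_eq openT _ (@Ck_cst R m R k setT ((basis_vec l : 'rV[R]_m) i j)) => y _.
have di : differentiable (@id 'rV[R]_m) y by [].
by rewrite -(derive_coord _ i j di) derive_id.
Qed.

Lemma smooth_at_linear {p q} (f : {linear 'rV[R]_m -> 'M[R]_(p, q)}) x :
  smooth_at f x.
Proof.
have S : smooth_at (fun y : 'rV[R]_m => \sum_i y 0 i *: f (delta_mx 0 i)) x.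
  apply: smooth_at_sum => i _; apply: smooth_atZl.
  exact: smooth_at_coord (smooth_at_id x).
apply: smooth_at_eq S; near=> y.
by rewrite [in RHS](row_sum_delta y) linear_sum; apply: eq_bigr => i _; rewrite linearZ.
Unshelve. all: by end_near. Qed.

Lemma smooth_at_comp {n p q} (f : 'rV[R]_m -> 'rV[R]_n)
    (g : 'rV[R]_n -> 'M[R]_(p, q)) x :
  smooth_at f x -> smooth_at g (f x) -> smooth_at (fun y => g (f y)) x.
Proof.
move=> sf [ O' [oO' O'x] Hg].
have : \forall y \near x, O' (f y).
  by apply: (smooth_at_continuous sf); exact: open_nbhs_nbhs.
move=> /near_open [ O'' [oO'' O''x] fO].
have [ O [oO Ox] Hf] := sf.
have oI : open (O `&` O'') by exact: openI.
exists (O `&` O'') => // k.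
apply: (Ck_comp (O' := O')) => //; first by move=> y [_ /fO].
by apply: CkW (Hf k) => y [].
Qed.

Lemma smooth_at_det {p} (A : 'rV[R]_m -> 'M[R]_p) x :
  smooth_at A x -> smooth_at (fun y => \det (A y)) x.
Proof.
move=> sA; apply: smooth_at_sum => s _; apply: smooth_atM.
  exact: smooth_at_cst.
by apply: smooth_at_prod => i _; exact: smooth_at_coord.
Qed.

(** Cramer's rule. [invmx] equals the adjugate over the determinant only at invertible matrices,
    hence near x because the determinant is continuous. *)
Lemma smooth_at_invmx {p} (A : 'rV[R]_m -> 'M[R]_p) x :
  smooth_at A x -> A x \in unitmx -> smooth_at (fun y => invmx (A y)) x.
Proof.
move=> sA uA.
have sd := smooth_at_det sA.
have dx : \det (A x) != 0 by rewrite -unitfE -unitmxE.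
have S : smooth_at (fun y => (\det (A y))^-1 *: \adj (A y)) x.
  apply: smooth_atZ; first exact: smooth_at_inv.
  apply: smooth_at_mx => i j.
  have S : smooth_at (fun y => cofactor (A y) j i) x.
    apply: smooth_atM; first exact: smooth_at_cst.
    apply: smooth_at_det; apply: smooth_at_mx => a b.
    apply: smooth_at_eq (smooth_at_coord (lift j a) (lift i b) sA).
    by near=> y; rewrite !mxE.
  by apply: smooth_at_eq S; near=> y; rewrite mxE.
apply: smooth_at_eq S.
have : \forall y \near x, \det (A y) != 0.
  by have /cvgr_neq0 := smooth_at_continuous sd; exact.
apply: filterS => y dy.
by rewrite /invmx unitmxE unitfE dy.
Unshelve. all: by end_near. Qed.

End SmoothAt.

(** * Symmetry of second derivatives *)

Section RealSchwarz.
Context {R : realType} {m : nat}.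
Implicit Types (x u v : 'rV[R]_m).

Lemma MVT_line (f : 'rV[R]_m -> R) x u (h : R) : 0 < h ->
  (forall s, 0 <= s <= h -> differentiable f (x + s *: u)) ->
  exists2 s, 0 <= s <= h & f (x + h *: u) - f x = 'D_u f (x + s *: u) * h.
Proof.
move=> h0 df.
have D s : 0 <= s <= h ->
    is_derive s 1 (fun r => f (x + r *: u)) ('D_u f (x + s *: u)).
  by move=> hs; apply: is_derive_line; exact: df.
have [||s + E] := @MVT _ (fun r => f (x + r *: u)) (fun s => 'D_u f (x + s *: u)) _ _ h0.
- by move=> s; rewrite in_itv /= => /andP[s0 sh]; apply: D; rewrite !ltW.
- apply: derivable_within_continuous => s; rewrite in_itv /= => hs.
  by have [] := D s hs.
rewrite in_itv /= => /andP[s0 sh]; exists s; first by rewrite !ltW.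
by move: E; rewrite scale0r addr0 subr0.
Qed.

(** The mean value theorem is used twice: along [u] for y |-> f(y + hv) - f(y), then along [v] for
    D_u f. *)
Lemma mixed_difference (f : 'rV[R]_m -> R) x u v (h : R) : 0 < h ->
  (forall s t, 0 <= s <= h -> 0 <= t <= h -> smooth_at f (x + s *: u + t *: v)) ->
  exists s t, [/\ 0 <= s <= h, 0 <= t <= h &
    f (x + h *: u + h *: v) - f (x + h *: u) - f (x + h *: v) + f x =
    'D_v ('D_u f) (x + s *: u + t *: v) * h * h].
Proof.
move=> h0 sf.
have h00 : 0 <= (0 : R) <= h by apply/andP; split => //; exact: ltW.
have hh : 0 <= h <= h by apply/andP; split => //; exact: ltW.
have sf0 s : 0 <= s <= h -> smooth_at f (x + s *: u).
  by move=> hs; have := sf s 0 hs h00; rewrite scale0r addr0.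
pose g y := f (y + h *: v) - f y.
have shf y : 'D_u (fun z => f (z + h *: v)) y = 'D_u f (y + h *: v).
  rewrite /derive; set F := (X in lim (X @ _) = _); set G := (X in _ = lim (X @ _)).
  by suff -> : F = G by []; apply/funext => r; rewrite /F /G /= addrA.
have dsh y : smooth_at f (y + h *: v) -> differentiable (fun z => f (z + h *: v)) y.
  move=> /smooth_at_diff df.
  apply: (@differentiable_comp _ _ _ _ (fun z : 'rV[R]_m => z + h *: v)) => //.
have dg s : 0 <= s <= h -> differentiable g (x + s *: u).
  move=> hs; apply: (@differentiableB _ _ _ (fun z => f (z + h *: v)) f).
    by apply: dsh; exact: sf.
  by apply: smooth_at_diff; exact: sf0.
have [s hs E] := MVT_line h0 dg.
have Dg : 'D_u g (x + s *: u) =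
    'D_u f (x + s *: u + h *: v) - 'D_u f (x + s *: u).
  rewrite -shf; apply: (@deriveB _ _ _ (fun z => f (z + h *: v)) f).
    by apply: diff_derivable; apply: dsh; exact: sf.
  by apply: diff_derivable; apply: smooth_at_diff; exact: sf0.
have [t ht|t ht E'] := @MVT_line ('D_u f) (x + s *: u) v h h0.
  by apply: smooth_at_diff; apply: smooth_at_deriv; exact: sf.
exists s, t; split => //.
rewrite -E' -Dg -E /g; lra.
Qed.

(* Both mixed derivatives are limits of the same second difference, which is
   symmetric in [u] and [v]. *)
Lemma Schwarz_real (f : 'rV[R]_m -> R) x u v : smooth_at f x ->
  'D_u ('D_v f) x = 'D_v ('D_u f) x.
Proof.
(* Two numbers at distance [d] cannot both lie within [d / 3] of a third; this will refute a
   positive gap between the mixed derivatives. *)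
move=> sf; have far (d a b c : R) : 0 < d -> d = `|a - b| -> `|a - c| < d / 3 ->
    `|b - c| < d / 3 -> False.
  move=> d0 Ed ac; rewrite distrC => bc.
  have : d <= `|a - c| + `|c - b|.
    by rewrite Ed; apply: le_trans (ler_normD _ _); rewrite addrA subrK.
  lra.
apply/eqP; rewrite -subr_eq0 -normr_eq0 -[_ == 0]negbK; apply/negP.
move=> d0.
have [d Ed] : exists d, d = `|'D_u ('D_v f) x - 'D_v ('D_u f) x| by eexists.
have {}d0 : 0 < d by rewrite Ed lt_def d0 normr_ge0.
have e0 : 0 < d / 3 by rewrite divr_gt0.
have c1 := smooth_at_continuous (smooth_at_deriv u (smooth_at_deriv v sf)).
have c2 := smooth_at_continuous (smooth_at_deriv v (smooth_at_deriv u sf)).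
have n1 : \forall y \near x, `|'D_u ('D_v f) x - 'D_u ('D_v f) y| < d / 3.
  by move/cvgrPdist_lt : c1 => /(_ _ e0).
have n2 : \forall y \near x, `|'D_v ('D_u f) x - 'D_v ('D_u f) y| < d / 3.
  by clear n1; move/cvgrPdist_lt : c2 => /(_ _ e0).
have n0 := smooth_at_near sf.
have := near_conj n0 (near_conj n1 n2).
move=> /nbhs_ballP[r /= r0 Hr].
(* This size keeps the whole parallelogram with sides hu and hv inside the ball of radius [r]; the
   summand 1 keeps the denominator positive when u = v = 0. *)
pose h := r / (2 * (`|u| + `|v| + 1)).
have den : 0 < 2 * (`|u| + `|v| + 1) by rewrite mulr_gt0 // ltr_wpDl // addr_ge0.
have h0 : 0 < h by rewrite divr_gt0.
have B s t : 0 <= s <= h -> 0 <= t <= h -> ball x r (x + s *: u + t *: v).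
  move=> /andP[s0 sh] /andP[t0 th]; rewrite -ball_normE /= distrC -(addrA x (s *: u)) addrAC subrr add0r.
  apply: le_lt_trans (ler_normD _ _) _; rewrite !normrZ !ger0_norm //.
  have := ler_wpM2r (normr_ge0 u) sh; have := ler_wpM2r (normr_ge0 v) th.
  have : h * (2 * (`|u| + `|v| + 1)) = r by rewrite /h divfK // gt_eqF.
  nra.
have [s [t [hs ht E1]]] := mixed_difference h0 (fun s t hs ht =>
   proj1 (Hr _ (B s t hs ht))).
have B' s' t' : 0 <= s' <= h -> 0 <= t' <= h -> ball x r (x + s' *: v + t' *: u).
  by move=> *; rewrite addrAC; exact: B.
have [s' [t' [hs' ht' E2]]] := mixed_difference h0 (fun s t hs ht =>
   proj1 (Hr _ (B' s t hs ht))).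
have E : 'D_v ('D_u f) (x + s *: u + t *: v) = 'D_u ('D_v f) (x + s' *: v + t' *: u).
  have hn : h != 0 by rewrite gt_eqF.
  have key (a b c c' : R) : c = a * h * h -> c' = b * h * h -> c = c' -> a = b.
    by move=> -> -> /(mulIf hn) /(mulIf hn).
  apply: (key _ _ _ _ E1 E2).
  by rewrite (addrAC x (h *: u) (h *: v)) [X in X + _]addrAC.
have [_ [_ b1]] := Hr _ (B s t hs ht); have [_ [b2 _]] := Hr _ (B' s' t' hs' ht').
rewrite E in b1; exact: (far _ _ _ _ d0 Ed b2 b1).
Qed.

End RealSchwarz.

(* Unifying two distinct derivatives would otherwise unfold the limits that
   define them. *)
#[local] Opaque derive diff jacobian.

Lemma Schwarz {R : realType} {m p q} (A : 'rV[R]_m -> 'M[R]_(p, q))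
    (x u v : 'rV[R]_m) : smooth_at A x ->
  'D_u ('D_v A) x = 'D_v ('D_u A) x.
Proof.
move=> sA; apply/matrixP => i j.
have D w w' : 'D_w ('D_w' A) x i j = 'D_w ('D_w' (fun y => A y i j)) x.
  rewrite derive_coord; last by apply: smooth_at_diff; exact: smooth_at_deriv.
  apply: near_eq_derive; near=> y.
  by rewrite derive_coord //; apply: smooth_at_diff; near: y; exact: smooth_at_near.
apply: etrans (D u v) (etrans _ (esym (D v u))).
exact: Schwarz_real (smooth_at_coord i j sA).
Unshelve. all: by end_near. Qed.

(** * Metrics in coordinates *)

Section CoordinateGeometry.
Context {R : realType} {n : nat}.
Implicit Types (G : 'rV[R]_n -> 'M[R]_n) (X Y Z y : 'rV[R]_n).

Definition ip (A : 'M[R]_n) (X Y : 'rV[R]_n) : R := (X *m A *m Y^T) 0 0.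

Lemma innerE {N : manifold R n} (h : N -> 'M[R]_n) p X Y :
  inner h p X Y = ip (h p) X Y.
Proof. by []. Qed.

Lemma ip_sym (A : 'M[R]_n) X Y : A^T = A -> ip A X Y = ip A Y X.
Proof.
move=> sA; rewrite /ip -[in RHS]sA -[Y]trmxK -!trmx_mul trmxK mulmxA.
by rewrite [RHS]mxE.
Qed.

Lemma ipBl (A : 'M[R]_n) X Y Z : ip A (X - Y) Z = ip A X Z - ip A Y Z.
Proof. by rewrite /ip !mulmxBl !mxE. Qed.

Lemma ip_expand (A : 'M[R]_n) X Y :
  ip A X Y = \sum_b \sum_c X 0 b * Y 0 c * A b c.
Proof.
rewrite /ip mxE exchange_big; apply: eq_bigr => c _ /=.
rewrite !mxE big_distrl; apply: eq_bigr => b _ /=; lra.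
Qed.

Lemma ip_nondegenerate (A : 'M[R]_n) X : A \in unitmx ->
  (forall Y, ip A X Y = 0) -> X = 0.
Proof.
move=> uA H; suff XA0 : X *m A = 0 by rewrite -(mulmxK uA X) XA0 mul0mx.
apply/rowP => j; have := H (delta_mx 0 j); rewrite /ip trmx_delta -colE !mxE.
by move->.
Qed.

(* Christoffel symbols of the metric with Gram matrix [G] in coordinates, and the
   associated bilinear form Gamma(X, Y). *)
Definition gamma G (y : 'rV[R]_n) (i j : 'I_n) : 'rV[R]_n :=
  let d (a b c : 'I_n) : R := 'D_(basis_vec a) (fun z : 'rV[R]_n => G z b c) y in
  \row_k (2^-1 * \sum_l invmx (G y) k l * (d i j l + d j i l - d l i j)).

Definition Gam G (y X Y : 'rV[R]_n) : 'rV[R]_n :=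
  \sum_b \sum_c (X 0 b * Y 0 c) *: gamma G y b c.

Lemma GamE G y X Y : Gam G y X Y = \sum_b \sum_c (X 0 b * Y 0 c) *: gamma G y b c.
Proof. by []. Qed.

Lemma christoffelE {N : manifold R n} (h : N -> 'M[R]_n) p :
  christoffel h p = gamma (metric_rep h p).
Proof. by []. Qed.

Lemma christoffel_formE {N : manifold R n} (h : N -> 'M[R]_n) p X Y :
  christoffel_form h p X Y = Gam (metric_rep h p) (chart p p) X Y.
Proof. by []. Qed.

Lemma GamDl G y X Y Z : Gam G y (X + Y) Z = Gam G y X Z + Gam G y Y Z.
Proof.
rewrite /Gam -big_split; apply: eq_bigr => b _; rewrite -big_split.
by apply: eq_bigr => c _; rewrite mxE mulrDl scalerDl.
Qed.

Lemma GamDr G y X Y Z : Gam G y X (Y + Z) = Gam G y X Y + Gam G y X Z.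
Proof.
rewrite /Gam -big_split; apply: eq_bigr => b _; rewrite -big_split.
by apply: eq_bigr => c _; rewrite mxE mulrDr scalerDl.
Qed.

Lemma GamZl G y (a : R) X Y : Gam G y (a *: X) Y = a *: Gam G y X Y.
Proof.
rewrite /Gam scaler_sumr; apply: eq_bigr => b _; rewrite scaler_sumr.
by apply: eq_bigr => c _; rewrite mxE -mulrA scalerA.
Qed.

Lemma GamZr G y (a : R) X Y : Gam G y X (a *: Y) = a *: Gam G y X Y.
Proof.
rewrite /Gam scaler_sumr; apply: eq_bigr => b _; rewrite scaler_sumr.
by apply: eq_bigr => c _; rewrite mxE mulrCA scalerA.
Qed.

Lemma GamBr G y X Y Z : Gam G y X (Y - Z) = Gam G y X Y - Gam G y X Z.
Proof. by rewrite GamDr -scaleN1r GamZr scaleN1r. Qed.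

(** Symmetry and invertibility are what the computations with Christoffel symbols draw on; the
    positivity of a Riemannian metric reaches them as invertibility, through
    [positive_definite_unit]. *)
Definition metric_at G y :=
  smooth_at G y /\ \forall z \near y, (G z)^T = G z /\ G z \in unitmx.

Lemma metric_at_near G y : metric_at G y -> \forall z \near y, metric_at G z.
Proof.
move=> [sG H]; have := near_conj (smooth_at_near sG) (near_join H).
by apply: filterS => z [].
Qed.

(** Multiplication by the Gram matrix lowers the index and leaves the Christoffel symbols of the
    first kind. *)
Lemma gamma_mulmx G y i j : metric_at G y ->
  let d (a b c : 'I_n) : R := ('D_(basis_vec a) G y) b c in
  gamma G y i j *m G y = 2^-1 *: \row_l (d i j l + d j i l - d l i j).
Proof.
move=> [sG /nbhs_singleton[symG uG]] d.
have dG := smooth_at_diff sG.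
have -> : gamma G y i j = 2^-1 *: ((\row_l (d i j l + d j i l - d l i j)) *m invmx (G y)).
  apply/rowP => k; rewrite !mxE; congr (_ * _); apply: eq_bigr => l _.
  rewrite mxE mulrC /d -!derive_coord //; congr (_ * _).
  by rewrite -[in LHS]symG -trmx_inv mxE.
by rewrite -scalemxAl mulmxKV.
Qed.

(** The Koszul formula for constant fields, where Gamma(X, Y) is nabla_X Y and all brackets vanish.
    Both sides are trilinear, and on basis vectors the identity is [gamma_mulmx]. *)
Lemma Koszul G y X Y Z : metric_at G y ->
  2 * ip (G y) (Gam G y X Y) Z =
  ip ('D_X G y) Y Z + ip ('D_Y G y) X Z - ip ('D_Z G y) X Y.
Proof.
move=> mG; have dG := smooth_at_diff mG.1.
have [d dE] : exists d, forall a b c : 'I_n, d a b c = ('D_(basis_vec a) G y) b c.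
  by exists (fun a b c => ('D_(basis_vec a) G y) b c).
have T U V W : ip ('D_U G y) V W =
    \sum_b \sum_c \sum_a U 0 a * V 0 b * W 0 c * d a b c.
  rewrite ip_expand; apply: eq_bigr => b _; apply: eq_bigr => c _.
  rewrite derive_basis // summxE big_distrr; apply: eq_bigr => a _ /=.
  by rewrite mxE -dE; ring.
have L b c : ip (G y) (gamma G y b c) Z =
    2^-1 * \sum_l (d b c l + d c b l - d l b c) * Z 0 l.
  rewrite /ip (gamma_mulmx b c mG) -scalemxAl mxE mxE; congr (_ * _).
  by apply: eq_bigr => l _; rewrite !mxE !dE.
have S : ip (G y) (Gam G y X Y) Z =
    \sum_b \sum_c (X 0 b * Y 0 c) * ip (G y) (gamma G y b c) Z.
  rewrite /ip /Gam !mulmx_suml summxE; apply: eq_bigr => b _.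
  rewrite !mulmx_suml summxE; apply: eq_bigr => c _.
  by rewrite -!scalemxAl mxE.
have E1 : ip ('D_X G y) Y Z = \sum_b \sum_c \sum_l X 0 b * Y 0 c * Z 0 l * d b c l.
  rewrite T; under eq_bigr do rewrite exchange_big.
  by rewrite exchange_big; apply: eq_bigr => b _; apply: eq_bigr => c _.
have E2 : ip ('D_Y G y) X Z = \sum_b \sum_c \sum_l X 0 b * Y 0 c * Z 0 l * d c b l.
  rewrite T; apply: eq_bigr => b _; rewrite exchange_big.
  apply: eq_bigr => c _; apply: eq_bigr => l _; ring.
have E3 : ip ('D_Z G y) X Y = \sum_b \sum_c \sum_l X 0 b * Y 0 c * Z 0 l * d l b c.
  rewrite T; apply: eq_bigr => b _; apply: eq_bigr => c _; apply: eq_bigr => l _; ring.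
rewrite S E1 E2 E3 big_distrr -sumrN -!big_split; apply: eq_bigr => b _ /=.
rewrite big_distrr -sumrN -!big_split; apply: eq_bigr => c _ /=.
have half (x s : R) : 2 * (x * (2^-1 * s)) = x * s by field.
rewrite L half big_distrr -sumrN -!big_split; apply: eq_bigr => l _ /=; ring.
Qed.

End CoordinateGeometry.

(** * Product rules and derivatives of the Christoffel form *)

Section DeriveRules.
Context {R : realType} {m : nat}.
Implicit Types (y v : 'rV[R]_m).

Lemma derive_suml (W : normedModType R) k (F : 'I_k -> 'rV[R]_m -> W) y v :
  (forall i, differentiable (F i) y) ->
  'D_v (fun z => \sum_i F i z) y = \sum_i 'D_v (F i) y.
Proof.
move=> dF; rewrite -derive_sum; last by move=> i; exact: diff_derivable.
by congr ('D_v _ y); apply/funext => z; rewrite fct_sumE.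
Qed.

Lemma derive_subf (W : normedModType R) (f g : 'rV[R]_m -> W) y v :
  differentiable f y -> differentiable g y ->
  'D_v (fun z => f z - g z) y = 'D_v f y - 'D_v g y.
Proof.
by move=> df dg; rewrite -(@deriveB _ _ _ f g) //; exact: diff_derivable.
Qed.

Lemma derive_scalec (W : normedModType R) (a : R) (f : 'rV[R]_m -> W) y v :
  differentiable f y -> 'D_v (fun z => a *: f z) y = a *: 'D_v f y.
Proof. by move=> df; rewrite -(@deriveZ _ _ _ f a) //; exact: diff_derivable. Qed.

Lemma derive_scale q r (f : 'rV[R]_m -> R) (A : 'rV[R]_m -> 'M[R]_(q, r)) y v :
  smooth_at f y -> smooth_at A y ->
  'D_v (fun z => f z *: A z) y = 'D_v f y *: A y + f y *: 'D_v A y.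
Proof.
move=> sf sA; apply/matrixP => i j.
rewrite derive_coord; last exact: smooth_at_diff (smooth_atZ sf sA).
have -> : (fun z => (f z *: A z) i j) = (f * (fun z => A z i j)).
  by apply/funext => z; rewrite mxE.
rewrite deriveM.
- rewrite !mxE -derive_coord; last exact: smooth_at_diff.
  by rewrite addrC; congr (_ + _); exact: mulrC.
- exact: diff_derivable (smooth_at_diff sf).
- exact: diff_derivable (smooth_at_diff (smooth_at_coord i j sA)).
Qed.

Lemma derive_mulf (f g : 'rV[R]_m -> R) y v :
  smooth_at f y -> smooth_at g y ->
  'D_v (fun z => f z * g z) y = 'D_v f y * g y + f y * 'D_v g y.
Proof.
move=> sf sg; rewrite (@deriveM _ _ f g).
- by rewrite addrC; congr (_ + _); exact: mulrC.
- exact: diff_derivable (smooth_at_diff sf).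
- exact: diff_derivable (smooth_at_diff sg).
Qed.

Lemma derive_mulmxr q r s (A : 'rV[R]_m -> 'M[R]_(q, r)) (B : 'M[R]_(r, s)) y v :
  smooth_at A y -> 'D_v (fun z => A z *m B) y = 'D_v A y *m B.
Proof.
move=> sA; rewrite (derive_mulmx _ (smooth_at_diff sA)); last first.
  exact: smooth_at_diff (smooth_at_cst B y).
by rewrite (_ : 'D_v (fun=> B) y = 0) ?mulmx0 ?addr0 //; exact: derive_cst.
Qed.

End DeriveRules.

Section ChristoffelCalculus.
Context {R : realType} {n : nat}.
Implicit Types (G : 'rV[R]_n -> 'M[R]_n) (X Y Z y : 'rV[R]_n).

Lemma smooth_at_gamma G y i j : metric_at G y -> smooth_at (fun z => gamma G z i j) y.
Proof.
move=> [sG /nbhs_singleton[_ uG]]; apply: smooth_at_mx => a b.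
have S : smooth_at (fun z => 2^-1 * \sum_l invmx (G z) b l *
    ('D_(basis_vec i) (fun z => G z j l) z + 'D_(basis_vec j) (fun z => G z i l) z
      - 'D_(basis_vec l) (fun z => G z i j) z)) y.
  apply: smooth_atM; first exact: smooth_at_cst.
  apply: smooth_at_sum => l _; apply: smooth_atM.
    by apply: smooth_at_coord; exact: smooth_at_invmx.
  apply: smooth_atD; last first.
    have := smooth_atM (smooth_at_cst (-1 : R) y) (smooth_at_deriv (basis_vec l) (smooth_at_coord i j sG)).
    by apply: smooth_at_eq; near=> z; rewrite mulN1r.
  by apply: smooth_atD; apply: smooth_at_deriv; exact: smooth_at_coord.
by apply: smooth_at_eq S; near=> z; rewrite /gamma mxE.
Unshelve. all: by end_near. Qed.

Lemma smooth_at_Gam m G (c A B : 'rV[R]_m -> 'rV[R]_n) (y : 'rV[R]_m) :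
  metric_at G (c y) -> smooth_at c y -> smooth_at A y -> smooth_at B y ->
  smooth_at (fun z => Gam G (c z) (A z) (B z)) y.
Proof.
move=> mG sc sA sB; apply: smooth_at_sum => i _; apply: smooth_at_sum => j _.
apply: smooth_atZ; first by apply: smooth_atM; exact: smooth_at_coord.
exact: (smooth_at_comp sc (smooth_at_gamma i j mG)).
Qed.

(** Product rule for a form that is bilinear in its arguments and varies with the base point; the
    last term moves the base point along [c] with both arguments frozen. *)
Lemma derive_Gam m G (c A B : 'rV[R]_m -> 'rV[R]_n) (y v : 'rV[R]_m) :
  metric_at G (c y) -> smooth_at c y -> smooth_at A y -> smooth_at B y ->
  'D_v (fun z => Gam G (c z) (A z) (B z)) y =
    Gam G (c y) ('D_v A y) (B y) + Gam G (c y) (A y) ('D_v B y)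
    + 'D_('D_v c y) (fun z => Gam G z (A y) (B y)) (c y).
Proof.
move=> mG sc sA sB.
have s1 i j : smooth_at (fun z => A z 0 i * B z 0 j) y.
  by apply: smooth_atM; exact: smooth_at_coord.
have s2 i j : smooth_at (fun z => gamma G (c z) i j) y.
  exact: (smooth_at_comp sc (smooth_at_gamma i j mG)).
rewrite derive_suml; last first.
  move=> i; apply: smooth_at_diff; apply: smooth_at_sum => j _.
  by apply: smooth_atZ.
rewrite derive_suml; last first.
  move=> i; apply: smooth_at_diff; apply: smooth_at_sum => j _.
  by apply: smooth_atZ; [exact: smooth_at_cst|exact: smooth_at_gamma].
rewrite /Gam -!big_split; apply: eq_bigr => i _ /=.
rewrite derive_suml; last first.
  by move=> j; apply: smooth_at_diff; apply: smooth_atZ.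
rewrite derive_suml; last first.
  move=> j; apply: smooth_at_diff.
  by apply: smooth_atZ; [exact: smooth_at_cst|exact: smooth_at_gamma].
rewrite -!big_split; apply: eq_bigr => j _ /=.
rewrite derive_scale // derive_mulf; try exact: smooth_at_coord.
rewrite -!derive_coord; try exact: smooth_at_diff.
rewrite scalerDl; congr (_ + _).
rewrite derive_scalec; last exact: smooth_at_diff (smooth_at_gamma i j mG).
by rewrite -(derive_comp v (smooth_at_diff sc) (smooth_at_diff (smooth_at_gamma i j mG))).
Qed.

End ChristoffelCalculus.

(** * Local isometries and the transformation law of Christoffel symbols *)

Section LocalIsometryLaw.
Context {R : realType} {n : nat}.
Implicit Types (G : 'rV[R]_n -> 'M[R]_n) (X Y Z y : 'rV[R]_n).

Lemma ip_delta (A : 'M[R]_n) i j : ip A (delta_mx 0 i) (delta_mx 0 j) = A i j.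
Proof. by rewrite /ip trmx_delta -rowE -colE !mxE. Qed.

Lemma ip_mulmx (A J : 'M[R]_n) X Y : ip A (X *m J) (Y *m J) = ip (J *m A *m J^T) X Y.
Proof. by rewrite /ip trmx_mul !mulmxA. Qed.

Lemma ip_isotropic (A : 'M[R]_n) X Y : X *m A = 0 -> ip A X Y = 0.
Proof. by rewrite /ip => ->; rewrite mul0mx mxE. Qed.

Lemma ip_inj (A B : 'M[R]_n) : (forall X Y, ip A X Y = ip B X Y) -> A = B.
Proof. by move=> H; apply/matrixP => i j; rewrite -!ip_delta H. Qed.

Lemma ip0l (A : 'M[R]_n) Y : ip A 0 Y = 0.
Proof. by rewrite /ip !mul0mx mxE. Qed.

Lemma ip0r (A : 'M[R]_n) X : ip A X 0 = 0.
Proof. by rewrite /ip trmx0 mulmx0 mxE. Qed.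

Lemma smooth_at_ip m (A : 'rV[R]_m -> 'M[R]_n) (B C : 'rV[R]_m -> 'rV[R]_n) (y : 'rV[R]_m) :
  smooth_at A y -> smooth_at B y -> smooth_at C y ->
  smooth_at (fun z => ip (A z) (B z) (C z)) y.
Proof.
move=> sA sB sC; apply: smooth_at_coord.
by apply: smooth_at_mulmx; [exact: smooth_at_mulmx|exact: smooth_at_trmx].
Qed.

Lemma derive_trmx m q r (A : 'rV[R]_m -> 'M[R]_(q, r)) (y v : 'rV[R]_m) : smooth_at A y ->
  'D_v (fun z => (A z)^T) y = ('D_v A y)^T.
Proof.
move=> sA; apply/matrixP => i j; rewrite mxE derive_coord; last first.
  exact: smooth_at_diff (smooth_at_trmx sA).
rewrite (derive_coord _ _ _ (smooth_at_diff sA)).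
by congr ('D_v _ y); apply/funext => z; rewrite mxE.
Qed.

Lemma derive_ip m (A : 'rV[R]_m -> 'M[R]_n) (B C : 'rV[R]_m -> 'rV[R]_n) (y v : 'rV[R]_m) :
  smooth_at A y -> smooth_at B y -> smooth_at C y ->
  'D_v (fun z => ip (A z) (B z) (C z)) y =
  ip ('D_v A y) (B y) (C y) + ip (A y) ('D_v B y) (C y) + ip (A y) (B y) ('D_v C y).
Proof.
move=> sA sB sC.
have sBA := smooth_at_mulmx sB sA.
have sC' := smooth_at_trmx sC.
rewrite /ip -derive_coord; last exact: smooth_at_diff (smooth_at_mulmx sBA sC').
rewrite (derive_mulmx _ (smooth_at_diff sBA) (smooth_at_diff sC')).
rewrite (derive_mulmx _ (smooth_at_diff sB) (smooth_at_diff sA)) (derive_trmx _ sC).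
by rewrite mulmxDl !mxE; congr (_ + _); rewrite addrC.
Qed.

(** The isometry equation is imposed on a neighbourhood because it is going to be differentiated. *)
Definition loc_isom G G' (F : 'rV[R]_n -> 'rV[R]_n) y :=
  [/\ smooth_at F y, metric_at G y, metric_at G' (F y) &
      \forall z \near y, forall X Y,
        ip (G z) X Y = ip (G' (F z)) ('D_X F z) ('D_Y F z)].

Lemma loc_isom_near G G' F y : loc_isom G G' F y -> \forall z \near y, loc_isom G G' F z.
Proof.
move=> [sF mG mG' H].
have n1 : \forall z \near y, metric_at G' (F z).
  by apply: (smooth_at_continuous sF); exact: metric_at_near.
have := near_conj (near_conj (smooth_at_near sF) (metric_at_near mG))
  (near_conj n1 (near_join H)).
by apply: filterS => z [[? ?] [? ?]].
Qed.

(** In matrices the isometry equation reads J G' J^T = G, and G is invertible. *)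
Lemma loc_isom_unit G G' F y : loc_isom G G' F y -> 'J F y \in unitmx.
Proof.
move=> [sF [_ /nbhs_singleton[_ uG]] _ /nbhs_singleton H].
have E : 'J F y *m G' (F y) *m ('J F y)^T = G y.
  apply: ip_inj => X Y; rewrite -ip_mulmx H.
  by rewrite !(deriveEjacobian _ (smooth_at_diff sF)).
suff /mulmx1_unit[] : 'J F y *m (G' (F y) *m ('J F y)^T *m invmx (G y)) = 1%:M by [].
by rewrite !mulmxA E mulmxV.
Qed.

(** The Jacobian being invertible, D_Z F runs through all vectors, so the nondegeneracy of G'
    applies. *)
Lemma loc_isom_nondegenerate G G' F y V : loc_isom G G' F y ->
  (forall Z, ip (G' (F y)) V ('D_Z F y) = 0) -> V = 0.
Proof.
move=> iF; have uJ := loc_isom_unit iF.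
have [sF _ [_ /nbhs_singleton[_ uG']] _] := iF.
move=> H; apply: (ip_nondegenerate uG') => Y.
have := H (Y *m invmx ('J F y)).
by rewrite (deriveEjacobian _ (smooth_at_diff sF)) mulmxKV.
Qed.

End LocalIsometryLaw.

#[local] Opaque ip Gam.

Section LocalIsometryHessian.
Context {R : realType} {n : nat}.
Implicit Types (G : 'rV[R]_n -> 'M[R]_n) (X Y Z y : 'rV[R]_n).

(* Transformation law of the Christoffel symbols: differentiate the isometry
   equation and use the Koszul formula on both sides. *)
Lemma loc_isom_hessian G G' F y X Y : loc_isom G G' F y ->
  'D_X ('D_Y F) y =
  'D_(Gam G y X Y) F y - Gam G' (F y) ('D_X F y) ('D_Y F y).
Proof.
move=> iF; have [sF mG mG' /[dup] /nbhs_singleton H nH] := iF.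
have [sG /nbhs_singleton[symG uG]] := mG.
have [sG' /nbhs_singleton[symG' uG']] := mG'.
have dG U V W : ip ('D_U G y) V W =
    ip ('D_('D_U F y) G' (F y)) ('D_V F y) ('D_W F y)
    + ip (G' (F y)) ('D_U ('D_V F) y) ('D_W F y)
    + ip (G' (F y)) ('D_V F y) ('D_U ('D_W F) y).
  have sGF := smooth_at_comp sF sG'.
  rewrite -(derive_comp _ (smooth_at_diff sF) (smooth_at_diff sG')).
  rewrite -(derive_ip U sGF (smooth_at_deriv V sF) (smooth_at_deriv W sF)).
  have <- : 'D_U (fun z => ip (G z) V W) y =
      'D_U (fun z => ip (G' (F z)) ('D_V F z) ('D_W F z)) y.
    by apply: near_eq_derive; apply: filterS nH => z ->.
  rewrite (derive_ip U sG (smooth_at_cst V y) (smooth_at_cst W y)).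
  by rewrite !derive_cst ip0l ip0r !addr0.
(* The derivatives of the isometry equation in directions X, Y, Z are combined with the signs of the
   Koszul formula. By Schwarz the terms [q], [r] cancel against [q'], [r'], and twice the product of
   D_X D_Y F with D_Z F remains. *)
have alg (k k' a b c t1 t2 t3 p p' q q' r r' : R) : 2 * k = a + b - c ->
    a = t1 + p + q -> b = t2 + p' + r -> c = t3 + q' + r' ->
    p' = p -> q' = q -> r' = r -> 2 * k' = t1 + t2 - t3 -> k - p - k' = 0.
  lra.
apply/eqP; rewrite eq_sym -subr_eq0 addrAC; apply/eqP.
apply: (loc_isom_nondegenerate iF) => Z; rewrite !ipBl.
have K1 := Koszul X Y Z mG; rewrite H in K1.
have K2 := Koszul ('D_X F y) ('D_Y F y) ('D_Z F y) mG'.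
have e1 := congr1 (fun W => ip (G' (F y)) W ('D_Z F y)) (Schwarz Y X sF).
have e2 := etrans (congr1 (fun W => ip (G' (F y)) W ('D_Y F y)) (Schwarz Z X sF))
  (ip_sym _ _ symG').
have e3 := congr1 (fun W => ip (G' (F y)) ('D_X F y) W) (Schwarz Z Y sF).
exact: (alg _ _ _ _ _ _ _ _ _ _ _ _ _ _ K1 (dG X Y Z) (dG Y X Z) (dG Z X Y) e1 e2 e3 K2).
Qed.

End LocalIsometryHessian.

(** * Invariance of curvature under local isometries *)

Section Curvature.
Context {R : realType} {n : nat}.
Implicit Types (G : 'rV[R]_n -> 'M[R]_n) (X Y Z y : 'rV[R]_n).

Definition curv G (y X Y Z : 'rV[R]_n) : 'rV[R]_n :=
  let Rm (i j k : 'I_n) : 'rV[R]_n :=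
    'D_(basis_vec i) (fun z : 'rV[R]_n => gamma G z j k) y
    - 'D_(basis_vec j) (fun z : 'rV[R]_n => gamma G z i k) y
    + \sum_l gamma G y j k 0 l *: gamma G y i l - \sum_l gamma G y i k 0 l *: gamma G y j l in
  \sum_i \sum_j \sum_k (X 0 i * Y 0 j * Z 0 k) *: Rm i j k.

Lemma curvatureE {N : manifold R n} (h : N -> 'M[R]_n) p X Y Z :
  curvature h p X Y Z = curv (metric_rep h p) (chart p p) X Y Z.
Proof. by []. Qed.

Lemma Gam_Gam G y X Y Z : Gam G y X (Gam G y Y Z) =
  \sum_i \sum_j \sum_k (X 0 i * Y 0 j * Z 0 k) *:
    \sum_l gamma G y j k 0 l *: gamma G y i l.
Proof.
rewrite GamE; apply: eq_bigr => i _.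
transitivity (\sum_l \sum_j \sum_k (X 0 i * Y 0 j * Z 0 k) *: (gamma G y j k 0 l *: gamma G y i l)).
  apply: eq_bigr => l _; rewrite GamE summxE big_distrr scaler_suml; apply: eq_bigr => j _.
  rewrite summxE big_distrr scaler_suml; apply: eq_bigr => k _.
  by rewrite /= mxE scalerA !mulrA.
rewrite exchange_big; apply: eq_bigr => j _; rewrite exchange_big; apply: eq_bigr => k _.
by rewrite scaler_sumr.
Qed.

Lemma derive_GamE G y X Y Z : metric_at G y ->
  'D_X (fun z => Gam G z Y Z) y =
  \sum_i \sum_j \sum_k (X 0 i * Y 0 j * Z 0 k) *:
    'D_(basis_vec i) (fun z : 'rV[R]_n => gamma G z j k) y.
Proof.
move=> mG.
have sc j k : smooth_at (fun z => (Y 0 j * Z 0 k) *: gamma G z j k) y.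
  by apply: smooth_atZ; [exact: smooth_at_cst|exact: smooth_at_gamma].
have -> : (fun z => Gam G z Y Z) = fun z => \sum_j \sum_k (Y 0 j * Z 0 k) *: gamma G z j k.
  by apply/funext => z; rewrite GamE.
rewrite derive_basis; last first.
  by apply: smooth_at_diff; apply: smooth_at_sum => j _; apply: smooth_at_sum => k _.
apply: eq_bigr => i _.
rewrite derive_suml; last first.
  by move=> j; apply: smooth_at_diff; apply: smooth_at_sum => k _.
rewrite scaler_sumr; apply: eq_bigr => j _.
rewrite derive_suml; last by move=> k; exact: smooth_at_diff.
rewrite scaler_sumr; apply: eq_bigr => k _.
rewrite derive_scalec; last exact: smooth_at_diff (smooth_at_gamma j k mG).
by rewrite scalerA mulrA.
Qed.

(** The formula for constant fields, without indices: in this form the derivatives of a local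
    isometry can be substituted for the arguments. *)
Lemma curvE G y X Y Z : metric_at G y ->
  curv G y X Y Z = 'D_X (fun z => Gam G z Y Z) y - 'D_Y (fun z => Gam G z X Z) y
    + Gam G y X (Gam G y Y Z) - Gam G y Y (Gam G y X Z).
Proof.
move=> mG.
have sw (f : 'I_n -> 'I_n -> 'I_n -> 'rV[R]_n) :
    \sum_j \sum_i \sum_k (Y 0 j * X 0 i * Z 0 k) *: f j i k =
    \sum_i \sum_j \sum_k (X 0 i * Y 0 j * Z 0 k) *: f j i k.
  rewrite exchange_big; apply: eq_bigr => i _; apply: eq_bigr => j _.
  by apply: eq_bigr => k _; rewrite [Y _ _ * _]mulrC.
rewrite !Gam_Gam !derive_GamE // !sw -!sumrN -!big_split; apply: eq_bigr => i _ /=.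
rewrite -!sumrN -!big_split; apply: eq_bigr => j _ /=.
rewrite -!sumrN -!big_split; apply: eq_bigr => k _ /=.
by rewrite !scalerDr !scalerN.
Qed.

(** The direction [c z] moves with the point: one term differentiates the direction, the other
    freezes it. *)
Lemma derive_dir (F c : 'rV[R]_n -> 'rV[R]_n) y X :
  smooth_at F y -> smooth_at c y ->
  'D_X (fun z => 'D_(c z) F z) y = 'D_('D_X c y) F y + 'D_X ('D_(c y) F) y.
Proof.
move=> sF sc.
have nF := smooth_at_near sF.
have -> : 'D_X (fun z => 'D_(c z) F z) y =
    'D_X (fun z => \sum_i c z 0 i *: 'D_(basis_vec i) F z) y.
  by apply: near_eq_derive; apply: filterS nF => z /smooth_at_diff/derive_basis ->.
have -> : 'D_X ('D_(c y) F) y = 'D_X (fun z => \sum_i c y 0 i *: 'D_(basis_vec i) F z) y.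
  by apply: near_eq_derive; apply: filterS nF => z /smooth_at_diff/derive_basis ->.
have sD i : smooth_at ('D_(basis_vec i) F) y by exact: smooth_at_deriv.
have sci i : smooth_at (fun z => c z 0 i) y by exact: smooth_at_coord.
rewrite derive_suml; last by move=> i; apply: smooth_at_diff; exact: smooth_atZ.
rewrite derive_suml; last first.
  by move=> i; apply: smooth_at_diff; apply: smooth_atZ => //; exact: smooth_at_cst.
rewrite (derive_basis _ (smooth_at_diff sF)) -big_split; apply: eq_bigr => i _ /=.
rewrite (derive_scale X (sci i) (sD i)) -(derive_coord _ _ _ (smooth_at_diff sc)).
by rewrite derive_scalec //; exact: smooth_at_diff.
Qed.

(** The derivative of [loc_isom_hessian], with second derivatives eliminated by the same law. One
    occurrence of D_X D_Y F is kept, since it is symmetric in X and Y and cancels upon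
    antisymmetrisation; two further terms are merely exchanged by swapping X and Y. *)
Lemma loc_isom_third G G' F y X Y Z : loc_isom G G' F y ->
  'D_X ('D_Y ('D_Z F)) y =
    'D_('D_X (fun z => Gam G z Y Z) y) F y
    + 'D_(Gam G y X (Gam G y Y Z)) F y
    - Gam G' (F y) ('D_X F y) ('D_(Gam G y Y Z) F y)
    - Gam G' (F y) ('D_X ('D_Y F) y) ('D_Z F y)
    - Gam G' (F y) ('D_Y F y) ('D_(Gam G y X Z) F y)
    + Gam G' (F y) ('D_Y F y) (Gam G' (F y) ('D_X F y) ('D_Z F y))
    - 'D_('D_X F y) (fun z => Gam G' z ('D_Y F y) ('D_Z F y)) (F y).
Proof.
move=> iF; have [sF mG mG' _] := iF.
have sc : smooth_at (fun z => Gam G z Y Z) y.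
  by apply: smooth_at_Gam => //; try exact: smooth_at_cst; exact: smooth_at_id.
have sDF V := smooth_at_deriv V sF.
have sdir : smooth_at (fun z => 'D_(Gam G z Y Z) F z) y.
  have S : smooth_at (fun z => \sum_i (Gam G z Y Z) 0 i *: 'D_(basis_vec i) F z) y.
    by apply: smooth_at_sum => i _; apply: smooth_atZ => //; exact: smooth_at_coord.
  apply: smooth_at_eq S; have := smooth_at_near sF.
  by apply: filterS => z /smooth_at_diff/derive_basis ->.
have sG' : smooth_at (fun z => Gam G' (F z) ('D_Y F z) ('D_Z F z)) y.
  exact: (smooth_at_Gam mG' sF (sDF Y) (sDF Z)).
have E0 : 'D_X ('D_Y ('D_Z F)) y = 'D_X (fun z => 'D_(Gam G z Y Z) F z
    - Gam G' (F z) ('D_Y F z) ('D_Z F z)) y.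
  apply: near_eq_derive; have := loc_isom_near iF; apply: filterS => z.
  exact: loc_isom_hessian.
have E1 := etrans E0 (derive_subf X (smooth_at_diff sdir) (smooth_at_diff sG')).
have E2 := derive_dir X sF sc.
have E3 := derive_Gam X mG' sF (sDF Y) (sDF Z).
have E4 := loc_isom_hessian X (Gam G y Y Z) iF.
have E5 : Gam G' (F y) ('D_Y F y) ('D_X ('D_Z F) y) =
    Gam G' (F y) ('D_Y F y) ('D_(Gam G y X Z) F y)
    - Gam G' (F y) ('D_Y F y) (Gam G' (F y) ('D_X F y) ('D_Z F y)).
  apply: etrans (congr1 (Gam G' (F y) ('D_Y F y)) (loc_isom_hessian X Z iF)) _.
  exact: GamBr.
have alg (L u w a1 a2' a2 s q' q d p g : 'rV[R]_n) :
    L = u - w -> u = a1 + a2' -> w = s + q' + d -> a2' = a2 - p -> q' = q - g ->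
    L = a1 + a2 - p - s - q + g - d.
  move=> -> -> -> -> ->; apply/rowP => i; rewrite !mxE; ring.
exact: (alg _ _ _ _ _ _ _ _ _ _ _ _ E1 E2 E3 E4 E5).
Qed.

(* The third derivative of [F] is symmetric, so antisymmetrising
   [loc_isom_third] in [X] and [Y] leaves only curvature terms. *)
Lemma loc_isom_curvature G G' F y X Y Z : loc_isom G G' F y ->
  curv G' (F y) ('D_X F y) ('D_Y F y) ('D_Z F y) = 'D_(curv G y X Y Z) F y.
Proof.
move=> iF; have [sF mG mG' _] := iF.
have alg (L L' s' a1 a2 p s q g d b1 b2 g' d' : 'rV[R]_n) :
  L = a1 + a2 - p - s - q + g - d -> L' = b1 + b2 - q - s' - p + g' - d' ->
  L = L' -> s = s' ->
  d - d' + g' - g = a1 - b1 + a2 - b2.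
  move=> -> -> + es; rewrite es => /rowP E.
  by apply/rowP => i; have := E i; rewrite !mxE; lra.
have E1 := loc_isom_third X Y Z iF.
have E2 := loc_isom_third Y X Z iF.
have e1 := Schwarz X Y (smooth_at_deriv Z sF).
have e2 := congr1 (fun W => Gam G' (F y) W ('D_Z F y)) (Schwarz X Y sF).
rewrite (curvE _ _ _ mG) (curvE _ _ _ mG').
have dF := smooth_at_diff sF.
rewrite (derive_subr _ _ dF) (derive_addr _ _ dF) (derive_subr _ _ dF).
exact: (alg _ _ _ _ _ _ _ _ _ _ _ _ _ _ E1 E2 e1 e2).
Qed.

End Curvature.

(** * Charts *)

Section Jacobians.
Context {R : realType}.

Lemma eq_mulmx {m n} (A B : 'M[R]_(m, n)) :
  (forall v : 'rV[R]_m, v *m A = v *m B) -> A = B.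
Proof. by move=> H; apply/row_matrixP => i; rewrite !rowE H. Qed.

Lemma jacobian_near {m n} (f g : 'rV[R]_m -> 'rV[R]_n) y : smooth_at f y ->
  (\forall z \near y, f z = g z) -> 'J f y = 'J g y.
Proof.
move=> sf fg; have sg := smooth_at_eq fg sf.
apply: eq_mulmx => v.
apply: etrans (esym (deriveEjacobian v (smooth_at_diff sf))) _.
exact: etrans (near_eq_derive v fg) (deriveEjacobian v (smooth_at_diff sg)).
Qed.

Lemma jacobian_comp {m n p} (f : 'rV[R]_m -> 'rV[R]_n) (g : 'rV[R]_n -> 'rV[R]_p) y :
  smooth_at f y -> smooth_at g (f y) ->
  'J (fun z => g (f z)) y = 'J f y *m 'J g (f y).
Proof.
move=> sf sg; apply: eq_mulmx => v.
have sc := smooth_at_comp sf sg.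
have df := smooth_at_diff sf; have dg := smooth_at_diff sg.
apply: etrans (esym (deriveEjacobian v (smooth_at_diff sc))) _.
apply: etrans (derive_comp v df dg) _.
by rewrite (deriveEjacobian _ dg) (deriveEjacobian v df) mulmxA.
Qed.

Lemma jacobian_id {m} (y : 'rV[R]_m) : 'J (fun z => z) y = 1%:M.
Proof.
have dI := smooth_at_diff (smooth_at_id y).
apply: eq_mulmx => v; apply: etrans (esym (deriveEjacobian v dI)) _.
by rewrite mulmx1; exact: derive_id.
Qed.

(** At an interior point of [A] the local extension has the same germ as [f]. *)
Lemma smooth_on_at {m} {W : normedModType R} (A : set 'rV[R]_m) (f : 'rV[R]_m -> W) y :
  smooth_on A f -> (\forall z \near y, A z) -> smooth_at f y.
Proof.
move=> sf nA; have [ O [F [oO Oy HF FE]]] := sf y (nbhs_singleton nA).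
apply: (smooth_at_eq (f := F)); last by exists O.
have nO : \forall z \near y, O z by exact: open_nbhs_nbhs.
by have := near_conj nA nO; apply: filterS => z [Az Oz]; exact: FE.
Qed.

Lemma smooth_at_on {m} {W : normedModType R} (A : set 'rV[R]_m) (f : 'rV[R]_m -> W) :
  (forall y, A y -> smooth_at f y) -> smooth_on A f.
Proof.
move=> H y Ay; have [ O [oO Oy] Hf] := H y Ay.
by exists O, f; split.
Qed.

End Jacobians.

Definition loc {R : realType} {m n} {M : manifold R m} {N : manifold R n} (f : M -> N)
  (p : M) (q : N) : 'rV[R]_m -> 'rV[R]_n := fun y => chart q (f (ichart p y)).

(** Indexed by the point x instead of its coordinates, so that the chain rule composes without
    inverse charts. The charts [p] and [q] are free; the preferred ones give [dmap]. *)
HB.lock Definition Dloc {R : realType} {m n} {M : manifold R m} {N : manifold R n}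
  (f : M -> N) (p : M) (q : N) (x : M) : 'M[R]_(m, n) := 'J (loc f p q) (chart p x).

HB.lock Definition mrep {R : realType} {n} {N : manifold R n} (h : N -> 'M[R]_n)
  (p : N) (y : 'rV[R]_n) : 'M[R]_n := metric_rep h p y.

Section Charts.
Context {R : realType}.

Lemma DlocE {m n} {M : manifold R m} {N : manifold R n} (f : M -> N) p q x :
  Dloc f p q x = 'J (loc f p q) (chart p x).
Proof. by rewrite Dloc.unlock. Qed.

(** A change of charts is treated as the differential of the identity map, so the cocycle relation
    is a case of the chain rule. *)
Definition trans {n} {N : manifold R n} (p q x : N) : 'M[R]_n := Dloc id p q x.

Lemma near_ccod {m} {M : manifold R m} (p : M) y : ccod p y ->
  \forall z \near y, ccod p z.
Proof. by move=> py; apply: open_nbhs_nbhs; split => //; exact: ccod_open. Qed.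

Lemma near_cdom {n} {N : manifold R n} (p x : N) : cdom p x ->
  \forall z \near x, cdom p z.
Proof. by move=> px; apply: open_nbhs_nbhs; split => //; exact: cdom_open. Qed.

Lemma near_loc {m n} {M : manifold R m} {N : manifold R n} (f : M -> N) p q y :
  {for ichart p y, continuous f} -> ccod p y -> cdom q (f (ichart p y)) ->
  \forall z \near y, ccod p z /\ cdom q (f (ichart p z)).
Proof.
move=> cf py qy; apply: near_conj; first exact: near_ccod.
have c : {for y, continuous (f \o ichart p)}.
  apply: continuous_comp; first exact: ichart_continuous.
  exact: cf.
exact: (c _ (near_cdom qy)).
Qed.

Lemma smooth_loc {m n} {M : manifold R m} {N : manifold R n} (f : M -> N) p q y :
  smooth_map f -> ccod p y -> cdom q (f (ichart p y)) -> smooth_at (loc f p q) y.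
Proof.
move=> [cf sf] py qy; apply: (smooth_on_at (sf p q)).
exact: (near_loc (cf (ichart p y)) py qy).
Qed.

Lemma smooth_map_id {n} {N : manifold R n} : smooth_map (@id N).
Proof.
split; first by move=> x; exact: cvg_id.
by move=> p q; have := @transition_smooth R n N p q.
Qed.

Lemma smooth_map_comp {m n l} {M : manifold R m} {N : manifold R n} {L : manifold R l}
  (f : M -> N) (g : N -> L) : smooth_map f -> smooth_map g -> smooth_map (g \o f).
Proof.
move=> sf sg; have [cf _] := sf; have [cg _] := sg; split.
  by move=> x; apply: continuous_comp; [exact: cf|exact: cg].
move=> p q; apply: smooth_at_on => y [py qy].
set r := f (ichart p y).
have ry : cdom r (f (ichart p y)) by exact: mem_cdom.
have s1 := smooth_loc sf py ry.
have s2 : smooth_at (loc g r q) (loc f p r y).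
  apply: smooth_loc => //; first exact: chart_ccod.
  by rewrite chartK.
apply: smooth_at_eq (smooth_at_comp s1 s2).
have := near_loc (cf (ichart p y)) py ry; apply: filterS => z [pz rz].
by rewrite /loc chartK.
Qed.

Lemma smooth_loc_chart {m n} {M : manifold R m} {N : manifold R n}
    (f : M -> N) p q x : smooth_map f -> cdom p x ->
  cdom q (f x) -> smooth_at (loc f p q) (chart p x).
Proof.
by move=> sf px qx; apply: smooth_loc => //; [exact: chart_ccod|rewrite chartK].
Qed.

Lemma loc_chart {m n} {M : manifold R m} {N : manifold R n}
    (f : M -> N) p q x : cdom p x -> loc f p q (chart p x) = chart q (f x).
Proof. by move=> px; rewrite /loc chartK. Qed.

Section Chain.
Context {m n l : nat} {M : manifold R m} {N : manifold R n} {L : manifold R l}.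

Lemma loc_comp (f : M -> N) (g : N -> L) p q r x :
  continuous f -> cdom p x -> cdom q (f x) ->
  \forall z \near chart p x, loc (g \o f) p r z = loc g q r (loc f p q z).
Proof.
move=> cf px qx.
have py := chart_ccod px.
have qy : cdom q (f (ichart p (chart p x))) by rewrite chartK.
have := near_loc (cf _) py qy; apply: filterS => z [pz qz].
by rewrite /loc chartK.
Qed.

(** Since all three charts are arbitrary, taking one of the maps to be [id] yields the
    change-of-chart formulas used throughout. *)
Lemma Dloc_comp (f : M -> N) (g : N -> L) p q r x :
  smooth_map f -> smooth_map g -> cdom p x -> cdom q (f x) -> cdom r (g (f x)) ->
  Dloc (g \o f) p r x = Dloc f p q x *m Dloc g q r (f x).
Proof.
move=> sf sg px qx rx.
have s1 := smooth_loc_chart sf px qx.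
have s2 := smooth_loc_chart sg qx rx.
rewrite !DlocE.
have J := @jacobian_comp _ _ _ _ _ (loc g q r) _ s1; rewrite (loc_chart f q px) in J.
have s12 := smooth_loc_chart (smooth_map_comp sf sg) px rx.
exact: etrans (jacobian_near s12 (loc_comp g r sf.1 px qx)) (J s2).
Qed.

End Chain.

Section Transitions.
Context {m n : nat} {M : manifold R m} {N : manifold R n}.

Lemma trans_id (p x : N) : cdom p x -> trans p p x = 1%:M.
Proof.
move=> px; rewrite -(jacobian_id (chart p x)) /trans DlocE; apply/esym/jacobian_near.
  exact: smooth_at_id.
have := near_ccod (chart_ccod px); apply: filterS => z pz.
by rewrite /loc ichartK.
Qed.

Lemma trans_comp (p q r x : N) : cdom p x -> cdom q x -> cdom r x ->
  trans p q x *m trans q r x = trans p r x.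
Proof.
move=> px qx rx.
exact: (esym (@Dloc_comp _ _ _ N N N id id p q r x smooth_map_id smooth_map_id px qx rx)).
Qed.

Lemma trans_unit (p q x : N) : cdom p x -> cdom q x -> trans p q x \in unitmx.
Proof.
move=> px qx.
have E := etrans (trans_comp px qx px) (trans_id px).
exact: (mulmx1_unit E).1.
Qed.

Lemma dmapE (f : M -> N) x : dmap f x = Dloc f x (f x) x.
Proof. by rewrite DlocE. Qed.

Lemma tcoordE (p q : N) X : tcoord p q X = X *m trans q p q.
Proof. by rewrite /trans DlocE. Qed.

Lemma mrepE (h : N -> 'M[R]_n) p x : cdom p x ->
  mrep h p (chart p x) = trans p x x *m h x *m (trans p x x)^T.
Proof. by move=> px; rewrite mrep.unlock /metric_rep chartK // /trans DlocE. Qed.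

Lemma mrep_metric_rep (h : N -> 'M[R]_n) p : metric_rep h p = mrep h p.
Proof. by rewrite mrep.unlock. Qed.

Lemma field_repE (V : N -> 'rV[R]_n) p x : cdom p x ->
  field_rep V p (chart p x) = V x *m trans x p x.
Proof. by move=> px; rewrite /field_rep chartK // /trans DlocE. Qed.

(** A vector of the kernel is isotropic, hence zero. *)
Lemma positive_definite_unit (A : 'M[R]_n) :
  (forall X, X != 0 -> 0 < ip A X X) -> A \in unitmx.
Proof.
move=> pA; rewrite -row_free_unit -kermx_eq0; apply/eqP/row_matrixP => i.
rewrite row0; apply/eqP/negPn/negP => /pA.
have -> : ip A (row i (kermx A)) (row i (kermx A)) = 0.
  by apply: ip_isotropic; rewrite -row_mul mulmx_ker row0.
by rewrite ltxx.
Qed.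

End Transitions.
End Charts.

#[local] Opaque metric_rep field_rep tcoord.

(** * Riemannian metrics and isometries read in charts *)

Section MetricsInCharts.
Context {R : realType} {n : nat}.

Definition isometric {N N' : manifold R n} (h : N -> 'M[R]_n) (h' : N' -> 'M[R]_n)
    (f : N -> N') : Prop :=
  smooth_map f /\
  forall x X Y, ip (h' (f x)) (X *m Dloc f x (f x) x) (Y *m Dloc f x (f x) x) = ip (h x) X Y.

Lemma isometry_isometric {N N' : manifold R n} (h : N -> 'M[R]_n) (h' : N' -> 'M[R]_n)
  (f : N -> N') : Defs.isometry h h' f -> isometric h h' f.
Proof. by move=> [[sf _] H]; split => // x X Y; rewrite -dmapE -!innerE H. Qed.

Lemma dmap_id {N : manifold R n} (x : N) : dmap id x = 1%:M.
Proof. by rewrite dmapE; exact: (trans_id (mem_cdom x)). Qed.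

Lemma isometric_id {N : manifold R n} (h : N -> 'M[R]_n) : isometric h h id.
Proof.
by split; [exact: smooth_map_id|move=> x X Y; rewrite -dmapE dmap_id !mulmx1].
Qed.

Context {N : manifold R n} {h : N -> 'M[R]_n} (rh : riemannian_metric h).

Lemma ip_mrep p x X Y : cdom p x ->
  ip (mrep h p (chart p x)) X Y = ip (h x) (X *m trans p x x) (Y *m trans p x x).
Proof. by move=> px; rewrite mrepE // ip_mulmx. Qed.

Lemma metric_at_rep p x : cdom p x -> metric_at (mrep h p) (chart p x).
Proof.
have [symh posh sh] := rh.
move=> px; have np := near_ccod (chart_ccod px); split.
  by rewrite -mrep_metric_rep; exact: smooth_on_at (sh p) np.
apply: filterS np => z pz.
have pa := ichart_cdom pz; rewrite -(ichartK pz) mrepE //.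
set a := ichart p z.
split; first by rewrite !trmx_mul trmxK symh mulmxA.
have uT := trans_unit pa (mem_cdom a).
rewrite !unitmx_mul unitmx_tr uT andbT /=.
by apply: positive_definite_unit => X; exact: posh.
Qed.

End MetricsInCharts.

Section LocalIsometries.
Context {R : realType} {n : nat} {N N' : manifold R n}.
Context {h : N -> 'M[R]_n} {h' : N' -> 'M[R]_n}.
Context (rh : riemannian_metric h) (rh' : riemannian_metric h').

(** For [f = id] this says that a change of charts is a local isometry between the two Gram
    matrices. *)
Lemma isometric_loc (f : N -> N') p q x : isometric h h' f -> cdom p x -> cdom q (f x) ->
  loc_isom (mrep h p) (mrep h' q) (loc f p q) (chart p x).
Proof.
move=> [sf isof] px qx; have py := chart_ccod px.
split; [exact: smooth_loc_chart|exact: metric_at_rep| |].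
  by rewrite loc_chart //; exact: metric_at_rep.
have qy : cdom q (f (ichart p (chart p x))) by rewrite chartK.
have := near_loc (sf.1 _) py qy; apply: filterS => z [pz qz] X Y.
have pa := ichart_cdom pz; rewrite -(ichartK pz).
move: qz pa; set a := ichart p z => qa pa.
have dF := smooth_at_diff (smooth_loc_chart sf pa qa).
(* The chart on either side may be changed before or after [f]: both products are the differential
   of [f] from chart [p] to the preferred chart at [f a]. *)
have E : trans p a a *m Dloc f a (f a) a = Dloc f p q a *m trans q (f a) (f a).
  have E1 := @Dloc_comp _ _ _ _ N N N' id f p a (f a) a smooth_map_id sf pa (mem_cdom a) (mem_cdom (f a)).
  have E2 := @Dloc_comp _ _ _ _ N N' N' f id p q (f a) a sf smooth_map_id pa qa (mem_cdom (f a)).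
  exact: etrans (esym E1) E2.
have D V : 'D_V (loc f p q) (chart p a) = V *m Dloc f p q a.
  by rewrite DlocE; exact: deriveEjacobian.
rewrite (D X).
rewrite (D Y).
rewrite (loc_chart f q pa).
apply: etrans (ip_mrep X Y pa) _; apply: etrans _ (esym (ip_mrep _ _ qa)).
have e V : V *m trans p a a *m Dloc f a (f a) a = V *m Dloc f p q a *m trans q (f a) (f a).
  by rewrite -!mulmxA E.
by rewrite -(isof a (X *m trans p a a)) !e.
Qed.

End LocalIsometries.

(** * Tension field and covariant derivatives *)

Section DirectionalDerivatives.
Context {R : realType} {m n k : nat}.
Implicit Types (f c : 'rV[R]_m -> 'rV[R]_n) (F : 'rV[R]_n -> 'rV[R]_k).

Lemma smooth_at_dir f c F y : smooth_at F (f y) -> smooth_at f y -> smooth_at c y ->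
  smooth_at (fun z => 'D_(c z) F (f z)) y.
Proof.
move=> sF sf sc.
have S : smooth_at (fun z => \sum_i c z 0 i *: 'D_(basis_vec i) F (f z)) y.
  apply: smooth_at_sum => i _; apply: smooth_atZ; first exact: smooth_at_coord.
  exact: (smooth_at_comp sf (smooth_at_deriv (basis_vec i) sF)).
apply: smooth_at_eq S.
have nF : \forall z \near y, smooth_at F (f z).
  by apply: (smooth_at_continuous sf); exact: smooth_at_near.
by apply: filterS nF => z /smooth_at_diff/derive_basis ->.
Qed.

Lemma derive_dir_comp f c F y X : smooth_at F (f y) -> smooth_at f y -> smooth_at c y ->
  'D_X (fun z => 'D_(c z) F (f z)) y =
  'D_('D_X c y) F (f y) + 'D_('D_X f y) ('D_(c y) F) (f y).
Proof.
move=> sF sf sc.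
have nF : \forall z \near y, smooth_at F (f z).
  by apply: (smooth_at_continuous sf); exact: smooth_at_near.
have sD i : smooth_at ('D_(basis_vec i) F) (f y) by exact: smooth_at_deriv.
have sDf i := smooth_at_comp sf (sD i).
have sci i : smooth_at (fun z => c z 0 i) y by exact: smooth_at_coord.
have E1 : 'D_X (fun z => 'D_(c z) F (f z)) y =
    'D_X (fun z => \sum_i c z 0 i *: 'D_(basis_vec i) F (f z)) y.
  by apply: near_eq_derive; apply: filterS nF => z /smooth_at_diff/derive_basis ->.
have E2 : 'D_('D_X f y) ('D_(c y) F) (f y) =
    'D_('D_X f y) (fun z => \sum_i c y 0 i *: 'D_(basis_vec i) F z) (f y).
  apply: near_eq_derive; have := smooth_at_near sF.
  by apply: filterS => z /smooth_at_diff/derive_basis ->.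
rewrite E1 E2 derive_suml; last by move=> i; apply: smooth_at_diff; exact: smooth_atZ.
rewrite derive_suml; last first.
  by move=> i; apply: smooth_at_diff; apply: smooth_atZ => //; exact: smooth_at_cst.
rewrite (derive_basis _ (smooth_at_diff sF)) -big_split; apply: eq_bigr => i _ /=.
rewrite (derive_scale X (sci i) (sDf i)) -(derive_coord _ _ _ (smooth_at_diff sc)).
congr (_ + _).
have := derive_comp X (smooth_at_diff sf) (smooth_at_diff (sD i)).
rewrite /comp => ->; apply/esym; apply: derive_scalec.
exact: smooth_at_diff (sD i).
Qed.

Lemma hessian_comp f F y X Y : smooth_at F (f y) -> smooth_at f y ->
  'D_X ('D_Y (fun z => F (f z))) y =
  'D_('D_X ('D_Y f) y) F (f y) + 'D_('D_X f y) ('D_('D_Y f y) F) (f y).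
Proof.
move=> sF sf; apply: etrans (derive_dir_comp X sF sf (smooth_at_deriv Y sf)).
apply: near_eq_derive.
have nF : \forall z \near y, smooth_at F (f z).
  by apply: (smooth_at_continuous sf); exact: smooth_at_near.
have := near_conj nF (smooth_at_near sf); apply: filterS => z [sFz sfz].
exact: (derive_comp Y (smooth_at_diff sfz) (smooth_at_diff sFz)).
Qed.

End DirectionalDerivatives.

Section GamBilinear.
Context {R : realType} {n : nat}.
Implicit Types (y : 'rV[R]_n).

Lemma Gam_suml {k} (G : 'rV[R]_n -> 'M[R]_n) y (c : 'I_k -> R) (A : 'I_k -> 'rV[R]_n) B :
  Gam G y (\sum_a c a *: A a) B = \sum_a c a *: Gam G y (A a) B.
Proof.
have z : Gam G y 0 B = 0 by have := GamZl G y 0 0 B; rewrite !scale0r.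
rewrite (big_morph (fun V => Gam G y V B) (id1 := 0) (op1 := +%R)) //.
  by apply: eq_bigr => a _; rewrite GamZl.
by move=> U V; exact: GamDl.
Qed.

Lemma Gam_sumr {k} (G : 'rV[R]_n -> 'M[R]_n) y (c : 'I_k -> R) (A : 'I_k -> 'rV[R]_n) B :
  Gam G y B (\sum_a c a *: A a) = \sum_a c a *: Gam G y B (A a).
Proof.
have z : Gam G y B 0 = 0 by have := GamZr G y 0 B 0; rewrite !scale0r.
rewrite (big_morph (fun V => Gam G y B V) (id1 := 0) (op1 := +%R)) //.
  by apply: eq_bigr => a _; rewrite GamZr.
by move=> U V; exact: GamDr.
Qed.

Lemma Gam_basis (G : 'rV[R]_n -> 'M[R]_n) y i j :
  Gam G y (basis_vec i) (basis_vec j) = gamma G y i j.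
Proof.
rewrite GamE (bigD1 i) //= (bigD1 j) //= !mxE !eqxx mulr1 scale1r.
rewrite big1 => [|c cj]; last by rewrite !mxE eqxx (negPf cj) mulr0 scale0r.
rewrite addr0 big1 ?addr0 // => b bi; rewrite big1 // => c _.
by rewrite !mxE eqxx (negPf bi) mul0r scale0r.
Qed.

End GamBilinear.

Lemma derive_lincomb_dir {R : realType} {m k} {W : normedModType R} (f : 'rV[R]_m -> W) y
    (c : 'I_k -> R) (A : 'I_k -> 'rV[R]_m) : differentiable f y ->
  'D_(\sum_a c a *: A a) f y = \sum_a c a *: 'D_(A a) f y.
Proof.
move=> df; rewrite (deriveE _ df) linear_sum; apply: eq_bigr => a _.
by rewrite linearZ (deriveE _ df).
Qed.

Lemma derive_sum_dir {R : realType} {m k} {W : normedModType R} (f : 'rV[R]_m -> W) y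
    (A : 'I_k -> 'rV[R]_m) : differentiable f y ->
  'D_(\sum_a A a) f y = \sum_a 'D_(A a) f y.
Proof.
move=> df; rewrite (deriveE _ df) linear_sum; apply: eq_bigr => a _.
by rewrite (deriveE _ df).
Qed.

(** Tracing a bilinear form over the images of the basis under J, with weights S, is tracing it over
    the basis with weights J^T S J. *)
Lemma bilinear_trace {R : realType} {m n} (q : 'I_m -> 'I_m -> 'rV[R]_n)
    (Q : 'rV[R]_m -> 'rV[R]_m -> 'rV[R]_n) (S J : 'M[R]_m) :
  (forall X Y, Q X Y = \sum_a \sum_b (X 0 a * Y 0 b) *: q a b) ->
  \sum_i \sum_j S i j *: Q (row i J) (row j J) =
  \sum_a \sum_b (J^T *m S *m J) a b *: q a b.
Proof.
move=> QE.
transitivity (\sum_i \sum_j \sum_a \sum_b (S i j * J i a * J j b) *: q a b).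
  apply: eq_bigr => i _; apply: eq_bigr => j _; rewrite QE scaler_sumr.
  apply: eq_bigr => a _; rewrite scaler_sumr; apply: eq_bigr => b _.
  by rewrite scalerA !mxE mulrA.
transitivity (\sum_a \sum_b \sum_i \sum_j (S i j * J i a * J j b) *: q a b).
  under eq_bigr => i _ do rewrite exchange_big.
  rewrite exchange_big; apply: eq_bigr => a _.
  under eq_bigr => i _ do rewrite exchange_big.
  by rewrite exchange_big.
apply: eq_bigr => a _; apply: eq_bigr => b _.
rewrite exchange_big mxE scaler_suml; apply: eq_bigr => j _ /=.
rewrite mxE mulr_suml scaler_suml; apply: eq_bigr => i _.
by rewrite mxE; congr (_ *: _); rewrite (mulrC (J i a)).
Qed.

(** * Naturality of the second fundamental form and of the tension field *)

Section SecondFundamentalForm.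
Context {R : realType} {m n : nat}.
Implicit Types (X Y y : 'rV[R]_m).

(* The second fundamental form nabla df in coordinates. *)
Definition second_form (G : 'rV[R]_m -> 'M[R]_m) (G' : 'rV[R]_n -> 'M[R]_n)
    (f : 'rV[R]_m -> 'rV[R]_n) y X Y : 'rV[R]_n :=
  'D_X ('D_Y f) y - 'D_(Gam G y X Y) f y + Gam G' (f y) ('D_X f y) ('D_Y f y).

Lemma second_form_near G G' (f f' : 'rV[R]_m -> 'rV[R]_n) y X Y :
  (\forall z \near y, f z = f' z) -> second_form G G' f y X Y = second_form G G' f' y X Y.
Proof.
move=> ff'; have e0 := nbhs_singleton ff'.
have e1 V := near_eq_derive V ff'.
have e2 : 'D_X ('D_Y f) y = 'D_X ('D_Y f') y.
  by apply: near_eq_derive; exact: near_eq_derive_near.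
by rewrite /second_form e2 !e1 e0.
Qed.

(** In the second-order chain rule the Hessian of F contributes dF of one Christoffel term and minus
    the other; the latter cancels against the Christoffel term of the target. *)
Lemma second_form_post G (G' G'' : 'rV[R]_n -> 'M[R]_n) (f : 'rV[R]_m -> 'rV[R]_n) F y X Y :
  smooth_at f y -> loc_isom G' G'' F (f y) ->
  second_form G G'' (fun z => F (f z)) y X Y = 'D_(second_form G G' f y X Y) F (f y).
Proof.
move=> sf iF; have [sF _ _ _] := iF.
have dF := smooth_at_diff sF; have df := smooth_at_diff sf.
have c V : 'D_V (fun z => F (f z)) y = 'D_('D_V f y) F (f y) := derive_comp V df dF.
have e1 := hessian_comp X Y sF sf.
have e2 := loc_isom_hessian ('D_X f y) ('D_Y f y) iF.
have e3 := f_equal2 (Gam G'' (F (f y))) (c X) (c Y).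
have e4 := c (Gam G y X Y).
have e5 := derive_addr ('D_X ('D_Y f) y - 'D_(Gam G y X Y) f y)
  (Gam G' (f y) ('D_X f y) ('D_Y f y)) dF.
have e6 := derive_subr ('D_X ('D_Y f) y) ('D_(Gam G y X Y) f y) dF.
have alg (a a1 a2 b b' d d1 g s t : 'rV[R]_n) :
    a = a1 + a2 -> a2 = b - g -> g = d -> d1 = b' -> s = t + b -> t = a1 - b' ->
    a - d1 + g = s.
  by move=> -> -> _ -> -> ->; apply/rowP => i; rewrite !mxE; ring.
rewrite /second_form e3.
exact: (alg _ _ _ _ _ _ _ _ _ _ e1 e2 erefl e4 e5 e6).
Qed.

(** Here the Hessian of P replaces the Christoffel term of the old metric on the domain by that of
    the new one. *)
Lemma second_form_pre (G0 G : 'rV[R]_m -> 'M[R]_m) G' (f : 'rV[R]_m -> 'rV[R]_n) P y X Y :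
  loc_isom G0 G P y -> smooth_at f (P y) ->
  second_form G0 G' (fun z => f (P z)) y X Y = second_form G G' f (P y) ('D_X P y) ('D_Y P y).
Proof.
move=> iP sf; have [sP _ _ _] := iP.
have dP := smooth_at_diff sP; have df := smooth_at_diff sf.
have c V : 'D_V (fun z => f (P z)) y = 'D_('D_V P y) f (P y) := derive_comp V dP df.
have e1 := hessian_comp X Y sf sP.
have e2 := loc_isom_hessian X Y iP.
have e3 := f_equal2 (Gam G' (f (P y))) (c X) (c Y).
have e4 := c (Gam G0 y X Y).
have e5 := derive_subr ('D_(Gam G0 y X Y) P y) (Gam G (P y) ('D_X P y) ('D_Y P y)) df.
have e6 := congr1 (fun V => 'D_V f (P y)) e2.
have alg (a a1 a2 b d g : 'rV[R]_n) :
    a = a1 + a2 -> a1 = b - d -> a - b + g = a2 - d + g.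
  by move=> -> ->; apply/rowP => i; rewrite !mxE; ring.
rewrite /second_form e3 e4.
exact: (alg _ _ _ _ _ _ e1 (etrans e6 e5)).
Qed.

Lemma second_form_expand G G' (f : 'rV[R]_m -> 'rV[R]_n) y X Y : smooth_at f y ->
  second_form G G' f y X Y =
  \sum_a \sum_b (X 0 a * Y 0 b) *: second_form G G' f y (basis_vec a) (basis_vec b).
Proof.
move=> sf; have df := smooth_at_diff sf.
have E (V : 'rV[R]_m) : V = \sum_a V 0 a *: basis_vec a by exact: row_sum_delta.
have E1 : 'D_X ('D_Y f) y =
    \sum_a \sum_b (X 0 a * Y 0 b) *: 'D_(basis_vec a) ('D_(basis_vec b) f) y.
  rewrite (derive_basis _ (smooth_at_diff (smooth_at_deriv Y sf))).
  (* Schwarz brings the direction [Y] outside, where it can be expanded in the basis, and a second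
     use restores the order. *)
  apply: eq_bigr => a _; rewrite (Schwarz _ _ sf).
  rewrite (derive_basis _ (smooth_at_diff (smooth_at_deriv _ sf))) scaler_sumr.
  by apply: eq_bigr => b _; rewrite scalerA (Schwarz _ _ sf).
have E2 : 'D_(Gam G y X Y) f y =
    \sum_a \sum_b (X 0 a * Y 0 b) *: 'D_(Gam G y (basis_vec a) (basis_vec b)) f y.
  rewrite {1}GamE.
  rewrite (derive_sum_dir _ df); apply: eq_bigr => a _.
  rewrite (derive_lincomb_dir _ _ df); apply: eq_bigr => b _.
  by rewrite Gam_basis.
have E3 : Gam G' (f y) ('D_X f y) ('D_Y f y) =
    \sum_a \sum_b (X 0 a * Y 0 b) *:
      Gam G' (f y) ('D_(basis_vec a) f y) ('D_(basis_vec b) f y).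
  apply: etrans (f_equal2 (Gam G' (f y)) (derive_basis X df) (derive_basis Y df)) _.
  rewrite Gam_suml; apply: eq_bigr => a _.
  rewrite Gam_sumr scaler_sumr; apply: eq_bigr => b _.
  by rewrite scalerA.
rewrite {1}/second_form E1 E2 E3 -sumrN -!big_split; apply: eq_bigr => a _ /=.
rewrite -sumrN -!big_split; apply: eq_bigr => b _ /=.
by rewrite /second_form !scalerDr scalerN.
Qed.

End SecondFundamentalForm.

(** Inverting J B J^T = A; the invertibility of J and B is itself drawn from that of A. *)
Lemma invmx_congruence {R : realType} {n} (A B J : 'M[R]_n) :
  A \in unitmx -> J *m B *m J^T = A -> J^T *m invmx A *m J = invmx B.
Proof.
move=> uA E.
have uJ : J \in unitmx.
  have H : J *m (B *m J^T *m invmx A) = 1%:M by rewrite !mulmxA E mulmxV.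
  exact: (mulmx1_unit H).1.
have uJT : J^T \in unitmx by rewrite unitmx_tr.
have EB : J^T *m invmx A *m J *m B = 1%:M.
  have K : J^T *m invmx A *m J *m B *m J^T = J^T.
    by rewrite -(mulmxA (J^T *m invmx A)) -(mulmxA (J^T *m invmx A)) E mulmxKV.
  by rewrite -[LHS](mulmxK uJT) K mulmxV.
have [_ uB] := mulmx1_unit EB.
by rewrite -[LHS](mulmxK uB) EB mul1mx.
Qed.

Section Tension.
Context {R : realType} {m n : nat} {M : manifold R m} {N : manifold R n}.
Context {g : M -> 'M[R]_m} {h : N -> 'M[R]_n}.

Lemma nabla_duE (u : M -> N) x i j : smooth_map u ->
  nabla_du g h u x i j =
  second_form (mrep g x) (mrep h (u x)) (loc u x (u x)) (chart x x) (basis_vec i) (basis_vec j).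
Proof.
move=> su; have sl := smooth_loc_chart su (mem_cdom x) (mem_cdom (u x)).
rewrite /second_form Gam_basis (loc_chart u (u x) (mem_cdom x)).
rewrite (derive_basis (gamma _ _ _ _) (smooth_at_diff sl)).
rewrite -!mrep_metric_rep -christoffel_formE -christoffelE.
by [].
Qed.

Context (rg : riemannian_metric g) (rh : riemannian_metric h).

(** Each component of nabla du is carried by the differential of [phi], and the trace over the
    domain is unchanged. *)
Lemma tension_post (f : M -> N) (phi : N -> N) x : smooth_map f -> isometric h h phi ->
  tension g h (phi \o f) x = tension g h f x *m dmap phi (f x).
Proof.
move=> sf iphi; have [sphi _] := iphi.
rewrite /tension mulmx_suml; apply: eq_bigr => i _.
rewrite mulmx_suml; apply: eq_bigr => j _; rewrite -scalemxAl; congr (_ *: _).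
rewrite nabla_duE //; last exact: smooth_map_comp.
rewrite nabla_duE //.
have xx := mem_cdom x; have fx := mem_cdom (f x); have pfx := mem_cdom (phi (f x)).
rewrite (second_form_near _ _ _ _ (loc_comp phi (phi (f x)) sf.1 xx fx)).
have sl := smooth_loc_chart sf xx fx.
have iF := isometric_loc rh rh iphi fx pfx.
have E := loc_chart f (f x) xx.
rewrite -E in iF.
rewrite (second_form_post _ _ _ sl iF) E dmapE DlocE; apply: deriveEjacobian.
by apply: smooth_at_diff; exact: smooth_loc_chart.
Qed.

(** The rows of the Jacobian J of [psi] are the images of the basis at x, and J g(psi x) J^T = g(x)
    turns the trace at x into the trace at [psi x]. *)
Lemma tension_pre (f : M -> N) (psi : M -> M) x : smooth_map f -> isometric g g psi ->
  tension g h (f \o psi) x = tension g h f (psi x).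
Proof.
move=> sf ipsi; have [spsi _] := ipsi.
have xx := mem_cdom x; have px := mem_cdom (psi x); have fpx := mem_cdom (f (psi x)).
have sl := smooth_loc_chart sf px fpx.
have sp := smooth_loc_chart spsi xx px.
have iP := isometric_loc rg rg ipsi xx px.
have E := loc_chart psi (psi x) xx.
have J : Dloc psi x (psi x) x *m g (psi x) *m (Dloc psi x (psi x) x)^T = g x.
  by apply: ip_inj => X Y; rewrite -ip_mulmx (ipsi.2 x).
have ug : g x \in unitmx.
  by have [_ pg _] := rg; apply: positive_definite_unit => X; exact: pg.
have SJ := invmx_congruence ug J.
pose Q := second_form (mrep g (psi x)) (mrep h (f (psi x))) (loc f (psi x) (f (psi x)))
  (chart (psi x) (psi x)).
have QE X Y : Q X Y = \sum_a \sum_b (X 0 a * Y 0 b) *: nabla_du g h f (psi x) a b.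
  apply: etrans (second_form_expand _ _ _ _ sl) _.
  by apply: eq_bigr => a _; apply: eq_bigr => b _; congr (_ *: _); apply/esym; exact: nabla_duE.
have D i : 'D_(basis_vec i) (loc psi x (psi x)) (chart x x) = row i (Dloc psi x (psi x) x).
  by rewrite rowE DlocE; apply: deriveEjacobian; exact: smooth_at_diff.
apply: etrans (etrans (bilinear_trace (invmx (g x)) (Dloc psi x (psi x) x) QE) _); last first.
  by rewrite SJ.
apply: eq_bigr => i _; apply: eq_bigr => j _; congr (_ *: _).
apply: etrans (nabla_duE _ _ _ (smooth_map_comp spsi sf)) _.
apply: etrans (second_form_near _ _ _ _ (loc_comp f (f (psi x)) spsi.1 xx px)) _.
rewrite -E in sl.
apply: etrans (second_form_pre _ _ _ iP sl) _.
by rewrite /Q (D i) (D j) E.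
Qed.

End Tension.

(** * Covariant derivatives of sections of a pull-back bundle *)

Section PullbackSections.
Context {R : realType} {m n : nat} {M : manifold R m} {N : manifold R n}.
Implicit Types (f : M -> N) (E : M -> 'rV[R]_m) (X : M -> 'rV[R]_n).

(** All values are transported to the single chart [q] of the target, so that they can be compared
    and differentiated. *)
Definition srep f X (p : M) (q : N) (z : 'rV[R]_m) : 'rV[R]_n :=
  X (ichart p z) *m trans (f (ichart p z)) q (f (ichart p z)).

Definition smooth_section f X : Prop := forall x p q, cdom p x -> cdom q (f x) ->
  smooth_at (srep f X p q) (chart p x).

(** The coordinate formula at every point of two fixed charts, whereas [cov_along] uses the centres
    of charts that change with the point; a covariant derivative can be differentiated again in this
    form. *)
Definition covrep (h : N -> 'M[R]_n) f E X p q z : 'rV[R]_n :=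
  'D_(field_rep E p z) (srep f X p q) z +
  Gam (mrep h q) (loc f p q z) ('D_(field_rep E p z) (loc f p q) z) (srep f X p q z).

Lemma srep_chart f X p q x : cdom p x ->
  srep f X p q (chart p x) = X x *m trans (f x) q (f x).
Proof. by move=> px; rewrite /srep chartK. Qed.

Lemma srep_center f X x : srep f X x (f x) (chart x x) = X x.
Proof. by rewrite srep_chart ?trans_id ?mulmx1 //; exact: mem_cdom. Qed.

Lemma field_rep_center E x : field_rep E x (chart x x) = E x.
Proof. by rewrite field_repE ?trans_id ?mulmx1 //; exact: mem_cdom. Qed.

Lemma derive_loc f p q x V : smooth_map f -> cdom p x -> cdom q (f x) ->
  'D_V (loc f p q) (chart p x) = V *m Dloc f p q x.
Proof.
move=> sf px qx; rewrite DlocE; apply: deriveEjacobian; apply: smooth_at_diff.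
exact: smooth_loc_chart.
Qed.

Lemma du_along_derive f E x : smooth_map f ->
  du_along f E x = 'D_(E x) (loc f x (f x)) (chart x x).
Proof. by move=> sf; rewrite (derive_loc _ sf (mem_cdom x) (mem_cdom (f x))) /du_along dmapE. Qed.

Lemma cov_alongE h f E X x : smooth_map f ->
  cov_along h f E X x = covrep h f E X x (f x) (chart x x).
Proof.
move=> sf; rewrite /covrep field_rep_center srep_center -(du_along_derive E x sf).
rewrite (loc_chart f _ (mem_cdom x)) -mrep_metric_rep -christoffel_formE /cov_along.
congr (_ + _); congr ('D_(E x) _ (chart x x)).
by apply/funext => z; rewrite tcoordE.
Qed.

Lemma smooth_at_field_rep E p x : smooth_vector_field E -> cdom p x ->
  smooth_at (field_rep E p) (chart p x).
Proof.
by move=> sE px; apply: (smooth_on_at (sE p)); exact: near_ccod (chart_ccod px).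
Qed.

Lemma smooth_section_du f E : smooth_map f -> smooth_vector_field E ->
  smooth_section f (du_along f E).
Proof.
move=> sf sE x p q px qx.
have sl := smooth_loc_chart sf px qx.
apply: smooth_at_eq (smooth_at_dir (f := id) sl (smooth_at_id _) (smooth_at_field_rep sE px)).
have qy : cdom q (f (ichart p (chart p x))) by rewrite chartK.
have := near_loc (sf.1 _) (chart_ccod px) qy; apply: filterS => z [pz qz].
have pa := ichart_cdom pz; rewrite -{1 2 3}(ichartK pz).
move: qz pa; set a := ichart p z => qa pa.
rewrite srep_chart // derive_loc // field_repE // /du_along dmapE.
have aa := mem_cdom a; have fa := mem_cdom (f a).
have E1 := @Dloc_comp _ _ _ _ M M N id f a p q a smooth_map_id sf aa pa qa.
have E2 := @Dloc_comp _ _ _ _ M N N f id a (f a) q a sf smooth_map_id aa fa qa.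
by rewrite -!mulmxA /trans -[in RHS]E2 -[in LHS]E1.
Qed.

End PullbackSections.

Section CovariantDerivative.
Context {R : realType} {m n : nat} {M : manifold R m} {N : manifold R n}.
Context {h : N -> 'M[R]_n} (rh : riemannian_metric h).
Implicit Types (f : M -> N) (E : M -> 'rV[R]_m) (X : M -> 'rV[R]_n).

(* With [phi] and [psi] the identity, this is the independence of the covariant
   derivative from the charts. *)
Lemma covrep_natural f E X (phi : N -> N) (psi : M -> M) X' p q x :
  smooth_map f -> smooth_section f X -> isometric h h phi -> smooth_map psi ->
  (forall x, E x *m Dloc psi x (psi x) x = E (psi x)) ->
  (forall x, X' x = X (psi x) *m
     Dloc phi (f (psi x)) (phi (f (psi x))) (f (psi x))) ->
  cdom p x -> cdom q (phi (f (psi x))) ->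
  covrep h (phi \o f \o psi) E X' p q (chart p x) =
  cov_along h f E X (psi x) *m Dloc phi (f (psi x)) q (f (psi x)).
Proof.
move=> sf sX iphi spsi EE XX px qx.
have sphi := iphi.1.
rewrite cov_alongE //.
have ww := mem_cdom (psi x); have fww := mem_cdom (f (psi x)).
move: qx ww fww; set w := psi x; set r := f w => qx ww fww.
set P := loc psi p w; set F := loc phi r q; set s := srep f X w r; set fh := loc f w r.
set y := chart p x.
have sP : smooth_at P y by exact: smooth_loc_chart.
have Py : P y = chart w w by rewrite /P loc_chart.
have ss : smooth_at s (P y) by rewrite Py; exact: sX.
have sfh : smooth_at fh (P y) by rewrite Py; exact: smooth_loc_chart.
have fPy : fh (P y) = chart r r by rewrite Py /fh loc_chart.
have iF : loc_isom (mrep h r) (mrep h q) F (fh (P y)).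
  by rewrite fPy; exact: isometric_loc.
have sF : smooth_at F (fh (P y)) by have [] := iF.
have DF V b : cdom r b -> cdom q (phi b) -> 'D_V F (chart r b) = V *m Dloc phi r q b.
  exact: derive_loc.
have npy : cdom w (psi (ichart p y)) by rewrite chartK.
have near1 := near_loc (spsi.1 _) (chart_ccod px) npy.
have nq : cdom q ((phi \o f \o psi) (ichart p y)) by rewrite /= chartK.
have sall := smooth_map_comp spsi (smooth_map_comp sf sphi).
have near2 := near_loc (sall.1 _) (chart_ccod px) nq.
have nr : cdom r ((f \o psi) (ichart p y)) by rewrite /= chartK.
have near3 := near_loc ((smooth_map_comp spsi sf).1 _) (chart_ccod px) nr.
(* Near x, the section X' in charts is the differential of F applied to the representative of X. *)
have nearS : \forall z \near y, 'D_(s (P z)) F (fh (P z)) = srep (phi \o f \o psi) X' p q z.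
  have := near_conj near1 (near_conj near2 near3); apply: filterS => z [[pz wz] [[_ qz] [_ rz]]].
  have pa := ichart_cdom pz; rewrite -{1 2 3}(ichartK pz).
  move: wz qz rz pa; set a := ichart p z => /= wa qa ra pa.
  rewrite srep_chart // /P loc_chart // /s srep_chart // /fh loc_chart // DF //.
  have fa := mem_cdom (f (psi a)); have pfa := mem_cdom (phi (f (psi a))).
  have E1 := @Dloc_comp _ _ _ _ N N N id phi _ _ _ _ smooth_map_id sphi fa ra qa.
  have E2 := @Dloc_comp _ _ _ _ N N N phi id _ _ _ _ sphi smooth_map_id fa pfa qa.
  by rewrite XX -!mulmxA /trans -[in RHS]E2 -[in LHS]E1.
have nearL : \forall z \near y, F (fh (P z)) = loc (phi \o f \o psi) p q z.
  have := near_conj near1 near3; apply: filterS => z [[pz wz] [_ rz]].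
  by rewrite /F /fh /P /loc !chartK.
set e := field_rep E p y.
have eP : 'D_e P y = E w.
  rewrite /P (derive_loc _ spsi px ww) /e field_repE // -mulmxA -EE.
  have xx := mem_cdom x.
  by rewrite /trans -(@Dloc_comp _ _ _ _ M M M id psi x p w x smooth_map_id spsi xx px ww).
have dP := smooth_at_diff sP.
have Dc : 'D_e (fun z => s (P z)) y = 'D_(E w) s (chart w w).
  by apply: etrans (derive_comp e dP (smooth_at_diff ss)) _; rewrite eP Py.
have Db : 'D_e (fun z => fh (P z)) y = 'D_(E w) fh (chart w w).
  by apply: etrans (derive_comp e dP (smooth_at_diff sfh)) _; rewrite eP Py.
have cy : s (P y) = X w by rewrite Py /s; exact: srep_center.
have sc := smooth_at_comp sP ss; have sb := smooth_at_comp sP sfh.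
have C := derive_dir_comp (f := fun z => fh (P z)) (c := fun z => s (P z))
  e sF sb sc; rewrite Dc Db cy fPy in C.
have C1 := etrans (esym (near_eq_derive e nearS)) C.
rewrite fPy in iF sF.
(* The second derivative of F is traded for Christoffel terms: that of the source completes the
   covariant derivative of X, that of the target cancels the one in [covrep]. *)
have H := loc_isom_hessian ('D_(E w) fh (chart w w)) (X w) iF.
have L0 := esym (nbhs_singleton nearL).
have S0 := esym (nbhs_singleton nearS).
have L1 := etrans (esym (near_eq_derive e nearL)) (derive_comp e (smooth_at_diff sb) _).
rewrite fPy Db in L1; rewrite cy fPy in S0; rewrite fPy in L0.
have {}L1 := L1 (smooth_at_diff sF).
rewrite /covrep -/e -/s -/fh field_rep_center L0 L1 S0 C1 H.
rewrite -(DF _ r (mem_cdom r)) //.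
have dF := smooth_at_diff sF.
have -> : s (chart w w) = X w by rewrite -Py.
rewrite (derive_addr _ _ dF).
rewrite -Py fPy.
by rewrite addrA subrK.
Qed.

End CovariantDerivative.

Section CovariantDerivativeNaturality.
Context {R : realType} {m n : nat} {M : manifold R m} {N : manifold R n}.
Context {h : N -> 'M[R]_n} (rh : riemannian_metric h).
Implicit Types (f : M -> N) (E : M -> 'rV[R]_m) (X : M -> 'rV[R]_n).

Lemma covrep_chart f E X p q x : smooth_map f -> smooth_section f X ->
  cdom p x -> cdom q (f x) ->
  covrep h f E X p q (chart p x) = cov_along h f E X x *m trans (f x) q (f x).
Proof.
move=> sf sX px qx.
apply: (covrep_natural rh (phi := id) (psi := id) (X' := X) sf sX _ smooth_map_id) => //.
- exact: isometric_id.
- by move=> w; have := trans_id (mem_cdom w); rewrite /trans => ->; rewrite mulmx1.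
- by move=> w; have := trans_id (mem_cdom (f w)); rewrite /trans => ->; rewrite mulmx1.
Qed.

(** By [covrep_chart] the representative of the covariant derivative is the function [covrep] near
    x, which is visibly smooth. *)
Lemma smooth_section_cov f E X : smooth_map f -> smooth_vector_field E ->
  smooth_section f X -> smooth_section f (cov_along h f E X).
Proof.
move=> sf sE sX x p q px qx.
have sl := smooth_loc_chart sf px qx.
have sEp := smooth_at_field_rep sE px.
have sXp := sX x p q px qx.
have mq : metric_at (mrep h q) (loc f p q (chart p x)).
  by rewrite loc_chart //; exact: metric_at_rep.
have S : smooth_at (covrep h f E X p q) (chart p x).
  apply: smooth_atD; first exact: (smooth_at_dir (f := id) sXp (smooth_at_id _) sEp).
  apply: smooth_at_Gam => //.
  exact: (smooth_at_dir (f := id) sl (smooth_at_id _) sEp).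
apply: smooth_at_eq S.
have qy : cdom q (f (ichart p (chart p x))) by rewrite chartK.
have := near_loc (sf.1 _) (chart_ccod px) qy; apply: filterS => z [pz qz].
have pa := ichart_cdom pz; rewrite -{1 2}(ichartK pz).
by rewrite covrep_chart // srep_chart.
Qed.

Lemma cov_along_natural f E X (phi : N -> N) (psi : M -> M) X' x :
  smooth_map f -> smooth_section f X -> isometric h h phi -> smooth_map psi ->
  (forall x, E x *m Dloc psi x (psi x) x = E (psi x)) ->
  (forall x, X' x = X (psi x) *m
     Dloc phi (f (psi x)) (phi (f (psi x))) (f (psi x))) ->
  cov_along h (phi \o f \o psi) E X' x =
  cov_along h f E X (psi x) *m Dloc phi (f (psi x)) (phi (f (psi x))) (f (psi x)).
Proof.
move=> sf sX iphi spsi EE XX.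
rewrite cov_alongE; last exact: smooth_map_comp spsi (smooth_map_comp sf iphi.1).
by apply: covrep_natural => //; exact: mem_cdom.
Qed.

Lemma curvature_natural (phi : N -> N) y (X Y Z : 'rV[R]_n) : isometric h h phi ->
  curvature h (phi y) (X *m Dloc phi y (phi y) y) (Y *m Dloc phi y (phi y) y)
    (Z *m Dloc phi y (phi y) y) = curvature h y X Y Z *m Dloc phi y (phi y) y.
Proof.
move=> iphi; have yy := mem_cdom y; have py := mem_cdom (phi y).
have iF := isometric_loc rh rh iphi yy py.
have C := loc_isom_curvature X Y Z iF.
have D V : 'D_V (loc phi y (phi y)) (chart y y) = V *m Dloc phi y (phi y) y.
  by apply: derive_loc => //; exact: iphi.1.
rewrite !curvatureE !mrep_metric_rep.
by move: C; rewrite (D X) (D Y) (D Z) (D (curv _ _ _ _ _)) loc_chart.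
Qed.

End CovariantDerivativeNaturality.

Section Tau2.
Context {R : realType} {m k : nat} {M : manifold R m} {N : manifold R (k + k)}.
Context {h : N -> 'M[R]_(k + k)} (rh : riemannian_metric h).

(** Naturality of the covariant derivative is applied twice, starting from du(E). In [tau2] every J
    acts outside the covariant derivatives, so that commuting with the differential of [phi]
    pointwise suffices. *)
Lemma tau2_natural (f : M -> N) E (phi : N -> N) (psi : M -> M) x :
  smooth_map f -> smooth_vector_field E -> isometric h h phi -> smooth_map psi ->
  (forall x, E x *m Dloc psi x (psi x) x = E (psi x)) ->
  (forall y X, cplxJ (X *m dmap phi y) = cplxJ X *m dmap phi y) ->
  tau2 h E (phi \o f \o psi) x = tau2 h E f (psi x) *m dmap phi (f (psi x)).
Proof.
move=> sf sE iphi spsi EE hol.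
have sphi := iphi.1.
have X1 w : du_along (phi \o f \o psi) E w =
    du_along f E (psi w) *m Dloc phi (f (psi w)) (phi (f (psi w))) (f (psi w)).
  have ww := mem_cdom w; have pw := mem_cdom (psi w).
  have fw := mem_cdom (f (psi w)); have pfw := mem_cdom (phi (f (psi w))).
  rewrite /du_along !dmapE -EE.
  have E1 := @Dloc_comp _ _ _ _ M M N psi f _ _ _ _ spsi sf ww pw fw.
  have E2 := @Dloc_comp _ _ _ _ M N N (f \o psi) phi _ _ _ _ (smooth_map_comp spsi sf) sphi ww fw pfw.
  by rewrite -!mulmxA (mulmxA (Dloc psi _ _ _)) -E1 -[in RHS]E2.
have s1 := smooth_section_du sf sE.
have s2 := smooth_section_cov rh sf sE s1.
have X2 w := cov_along_natural rh w sf s1 iphi spsi EE X1.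
have X3 w := cov_along_natural rh w sf s2 iphi spsi EE X2.
have hol' y X : cplxJ (X *m Dloc phi y (phi y) y) = cplxJ X *m Dloc phi y (phi y) y.
  by rewrite -dmapE hol.
rewrite /tau2 X3 X1 dmapE /= !hol' (curvature_natural rh _ _ _ _ iphi).
by rewrite mulmxDl mulNmx -scalemxAl.
Qed.

End Tau2.

(** * One-parameter groups and velocities *)

Lemma cvg_pair_at {T U V : topologicalType} (f : T -> U) (g : T -> V) (x : T) :
  f @ x --> f x -> g @ x --> g x -> (fun t => (f t, g t)) @ x --> (f x, g x).
Proof. by move=> cf cg; exact: cvg_pair. Qed.

Section Families.
Context {R : realType}.

(* Coordinates of the point (t, x) of the product R * M. *)
Definition tpt {m} (t : R) (y : 'rV[R]_m) : 'rV[R]_(1 + m) := row_mx (t%:M : 'M[R]_1) y.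

Lemma tpt_l {m} t (y : 'rV[R]_m) : lsubmx (tpt t y) 0 0 = t.
Proof. by rewrite row_mxKl mxE eqxx. Qed.

Lemma tpt_r {m} t (y : 'rV[R]_m) : rsubmx (tpt t y) = y.
Proof. by rewrite row_mxKr. Qed.

Lemma tptE {m} t (y : 'rV[R]_m) : tpt t y = t *: tpt 1 0 + y *m row_mx 0 1%:M.
Proof.
by rewrite /tpt scale_row_mx mul_mx_row mulmx0 mulmx1
  add_row_mx scaler0 addr0 add0r scale_scalar_mx mulr1.
Qed.

Lemma smooth_at_tpt {l m} (a : 'rV[R]_l -> R) (b : 'rV[R]_l -> 'rV[R]_m) y :
  smooth_at a y -> smooth_at b y -> smooth_at (fun z => tpt (a z) (b z)) y.
Proof.
move=> sa sb.
have S : smooth_at (fun z => a z *: tpt 1 0 + b z *m row_mx 0 1%:M) y.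
  apply: smooth_atD; first exact: smooth_atZl.
  by apply: smooth_at_mulmx => //; exact: smooth_at_cst.
have <- : (fun z => a z *: tpt 1 0 + b z *m row_mx 0 1%:M) = fun z => tpt (a z) (b z).
  by apply/funext => z; rewrite -tptE.
exact: S.
Qed.

Lemma smooth_at_lsub {m} (z : 'rV[R]_(1 + m)) :
  smooth_at (fun z : 'rV[R]_(1 + m) => lsubmx z 0 0) z.
Proof. exact: (smooth_at_coord 0 0 (smooth_at_linear lsubmx z)). Qed.

Lemma smooth_at_rsub {m} (z : 'rV[R]_(1 + m)) :
  smooth_at (fun z : 'rV[R]_(1 + m) => rsubmx z) z.
Proof. exact: (smooth_at_linear rsubmx z). Qed.

Section Joint.
Context {m n : nat} {M : manifold R m} {N : manifold R n}.
Implicit Types (F : R -> M -> N).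

Definition jloc F (p : M) (q : N) (z : 'rV[R]_(1 + m)) : 'rV[R]_n :=
  chart q (F (lsubmx z 0 0) (ichart p (rsubmx z))).

Lemma jloc_tpt F p q t x : cdom p x -> jloc F p q (tpt t (chart p x)) = chart q (F t x).
Proof. by move=> px; rewrite /jloc tpt_l tpt_r chartK. Qed.

Lemma smooth_family_continuous F : smooth_family setT F ->
  continuous (fun z : R * M => F z.1 z.2).
Proof. by move=> [cF _]; apply/continuous_subspace_setT. Qed.

Lemma near_jloc F p q (z : 'rV[R]_(1 + m)) : continuous (fun z : R * M => F z.1 z.2) ->
  ccod p (rsubmx z) -> cdom q (F (lsubmx z 0 0) (ichart p (rsubmx z))) ->
  \forall z' \near z, ccod p (rsubmx z') /\
    cdom q (F (lsubmx z' 0 0) (ichart p (rsubmx z'))).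
Proof.
move=> cF pz qz.
have cr := smooth_at_continuous (smooth_at_rsub z).
have cl := smooth_at_continuous (smooth_at_lsub z).
apply: near_conj; first exact: (cr _ (near_ccod pz)).
have c2 : {for z, continuous (fun z' : 'rV[R]_(1 + m) => ichart p (rsubmx z'))}.
  by apply: continuous_comp; [exact: cr|exact: ichart_continuous].
have c12 : (fun z' : 'rV[R]_(1 + m) => (lsubmx z' 0 0, ichart p (rsubmx z'))) @ z -->
    (lsubmx z 0 0, ichart p (rsubmx z)).
  exact: cvg_pair_at cl c2.
have c := cvg_comp _ _ c12 (cF (lsubmx z 0 0, ichart p (rsubmx z))).
exact: (c _ (near_cdom qz)).
Qed.

Lemma smooth_jloc F p q (z : 'rV[R]_(1 + m)) : smooth_family setT F ->
  ccod p (rsubmx z) -> cdom q (F (lsubmx z 0 0) (ichart p (rsubmx z))) ->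
  smooth_at (jloc F p q) z.
Proof.
move=> sF pz qz; have [_ /(_ p q) H] := sF.
apply: (smooth_on_at H).
by have := near_jloc (smooth_family_continuous sF) pz qz; apply: filterS => z' [? ?].
Qed.

Lemma smooth_jloc_tpt F p q t x : smooth_family setT F -> cdom p x -> cdom q (F t x) ->
  smooth_at (jloc F p q) (tpt t (chart p x)).
Proof.
move=> sF px qx; apply: smooth_jloc => //; first by rewrite tpt_r; exact: chart_ccod.
by rewrite tpt_l tpt_r chartK.
Qed.

(** [F], being defined for all times, supplies the local smooth extension required at an end point
    of [I]. *)
Lemma smooth_familyW (I : set R) F u : smooth_family setT F ->
  (forall t x, I t -> u t x = F t x) -> smooth_family I u.
Proof.
move=> sF uF; have cF := smooth_family_continuous sF; split.
  apply: (@subspace_eq_continuous _ _ _ (fun z : R * M => F z.1 z.2)).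
    by move=> [t x]; rewrite inE /= => It; exact: (esym (uF t x It)).
  exact: continuous_subspaceT.
move=> p q G z [Iz pz qz].
have qz' : cdom q (F (lsubmx z 0 0) (ichart p (rsubmx z))) by rewrite -uF.
have [ O [oO Oz] H] := smooth_jloc sF pz qz'.
exists O, (jloc F p q); split => // z' _ [Iz' _ _].
by rewrite /jloc /G /= uF.
Qed.

End Joint.

End Families.

Section Composite.
Context {R : realType} {m n : nat} {M : manifold R m} {N : manifold R n}.

(** In coordinates this is [jloc phi] applied to (t, v(psi_t x)), read in the preferred charts at
    the points [a] and [b] reached from [z]. *)
Lemma smooth_family_composite (psi : R -> M -> M) (v : M -> N) (phi : R -> N -> N) :
  smooth_family setT psi -> smooth_map v -> smooth_family setT phi ->
  smooth_family setT (fun t x => phi t (v (psi t x))).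
Proof.
move=> spsi sv sphi.
have cpsi := smooth_family_continuous spsi; have cphi := smooth_family_continuous sphi.
have cU : continuous (fun z : R * M => phi z.1 (v (psi z.1 z.2))).
  move=> z.
  have c1 : (fun z : R * M => (z.1, v (psi z.1 z.2))) @ z --> (z.1, v (psi z.1 z.2)).
    apply: (@cvg_pair_at _ _ _ (fun z : R * M => z.1) (fun z : R * M => v (psi z.1 z.2))).
      exact: cvg_fst.
    exact: (cvg_comp _ _ (cpsi z) (sv.1 _)).
  exact: (cvg_comp _ _ c1 (cphi (z.1, v (psi z.1 z.2)))).
split; first by apply: continuous_subspaceT.
move=> p q G; apply: smooth_at_on => z [_ pz qz].
set t := lsubmx z 0 0; set x := ichart p (rsubmx z).
pose a := psi t x; pose b := v a.
have aa : cdom a (psi t x) by exact: mem_cdom.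
have bb : cdom b (v (psi t x)) by exact: mem_cdom.
have s1 : smooth_at (jloc psi p a) z by exact: smooth_jloc.
have E1 : jloc psi p a z = chart a a by [].
have s2 : smooth_at (loc v a b) (jloc psi p a z).
  by rewrite E1; exact: smooth_loc_chart.
have s3 := smooth_at_tpt (smooth_at_lsub z) (smooth_at_comp s1 s2).
have E2 : loc v a b (jloc psi p a z) = chart b b by rewrite E1 loc_chart.
have s4 : smooth_at (jloc phi b q) (tpt (lsubmx z 0 0) (loc v a b (jloc psi p a z))).
  by rewrite E2; apply: smooth_jloc_tpt => //; exact: mem_cdom.
apply: smooth_at_eq (smooth_at_comp s3 s4).
have n1 := near_jloc cpsi pz aa.
have cV : continuous (fun z : R * M => v (psi z.1 z.2)).
  by move=> w; exact: (cvg_comp _ _ (cpsi w) (sv.1 _)).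
have n2 := near_jloc (F := fun t x => v (psi t x)) cV pz bb.
have := near_conj n1 n2; apply: filterS => w [[_ aw] [_ bw]].
by rewrite {1}/jloc tpt_l tpt_r /loc /jloc !chartK.
Qed.

End Composite.

#[local] Transparent derive.

(** * Velocities of curves and of flows *)

Section Curves.
Context {R : realType}.

Lemma cvg_dnbhs_shift {W : normedModType R} (f : R -> W) (t : R) (w : W) :
  f @ t^' --> w <-> (fun h => f (h + t)) @ 0^' --> w.
Proof.
have c1 : (fun h => h + t) @ (0 : R) --> t.
  by rewrite -[X in _ --> X]add0r; apply: cvgD; [exact: cvg_id|exact: cvg_cst].
have c2 : (fun s => s - t) @ t --> (0 : R).
  by rewrite -[X in _ --> X](subrr t); apply: cvgB; [exact: cvg_id|exact: cvg_cst].
split => H P /H nP.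
- have {}nP : \forall s \near t, s != t -> P (f s) by exact: nP.
  suff : \forall h \near 0, h != 0 -> P (f (h + t)) by [].
  have nP' : \forall h \near 0, h + t != t -> P (f (h + t)) by exact: (c1 _ nP).
  apply: filterS nP' => h K h0; apply: K.
  by apply: contra_neq h0 => /eqP; rewrite -subr_eq0 addrK => /eqP.
- have {}nP : \forall h \near 0, h != 0 -> P (f (h + t)) by exact: nP.
  suff : \forall s \near t, s != t -> P (f s) by [].
  have nP' : \forall s \near t, s - t != 0 -> P (f (s - t + t)) by exact: (c2 _ nP).
  apply: filterS nP' => s K s0; rewrite -(subrK t s); apply: K.
  by rewrite subr_eq0.
Qed.

Lemma is_derive_cvg {W : normedModType R} (f : R -> W) (t : R) (w : W) :
  is_derive t 1 f w <-> (fun s => (s - t)^-1 *: (f s - f t)) @ t^' --> w.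
Proof.
rewrite cvg_dnbhs_shift.
have -> : (fun h : R => (h + t - t)^-1 *: (f (h + t) - f t)) =
    (fun h : R => h^-1 *: ((f \o shift t) (h *: 1) - f t)).
  by apply/funext => h /=; rewrite addrK [h *: 1]mulr1.
split => [[df <-]|H]; first exact: df.
split; first by apply/cvg_ex; exists w.
exact: cvg_lim H.
Qed.

Lemma is_derive_comp1 {m n} (c : R -> 'rV[R]_m) (f : 'rV[R]_m -> 'rV[R]_n) (t : R) w :
  is_derive t 1 c w -> differentiable f (c t) ->
  is_derive t 1 (fun s => f (c s)) ('D_w f (c t)).
Proof.
move=> [dc <-] df.
have dc' : differentiable c t by exact/derivable1_diffP.
have dfc : differentiable (f \o c) t by exact: differentiable_comp.
split; first exact/diff_derivable.
have E := deriveE (1 : R) dfc; rewrite (diff_comp dc' df) /= in E.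
by rewrite (deriveE _ df) (deriveE (1 : R) dc').
Qed.

Lemma is_derive_tpt {m} (c : R -> 'rV[R]_m) (t : R) w : is_derive t 1 c w ->
  is_derive t 1 (fun s => tpt s (c s)) (tpt 1 w).
Proof.
move=> dc.
have sL y : smooth_at (fun y : 'rV[R]_m => y *m row_mx 0 1%:M : 'rV[R]_(1 + m)) y.
  by apply: smooth_at_mulmx; [exact: smooth_at_id|exact: smooth_at_cst].
have d1 := is_derive_comp1 dc (smooth_at_diff (sL (c t))).
rewrite derive_mulmxr in d1; last exact: smooth_at_id.
rewrite derive_id in d1.
have d2 : is_derive t 1 (fun s : R => s *: (tpt 1 0 : 'rV[R]_(1 + m))) (tpt 1 0).
  have d : is_derive t 1 (fun s : R => 0 + s *: (tpt 1 0 : 'rV[R]_(1 + m)))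
     ('D_(tpt 1 0) id (0 + t *: (tpt 1 0 : 'rV[R]_(1 + m)))).
    exact: is_derive_line.
  rewrite derive_id in d.
  by have -> : (fun s : R => s *: (tpt 1 0 : 'rV[R]_(1 + m))) =
    (fun s : R => 0 + s *: (tpt 1 0 : 'rV[R]_(1 + m))) by apply/funext => s; rewrite add0r.
have := is_deriveD d2 d1.
have -> : (tpt 1 0 + w *m row_mx 0 1%:M) = tpt 1 w by rewrite -[tpt 1 0]scale1r -tptE.
have -> // : (fun s => tpt s (c s)) = (fun s : R => s *: (tpt 1 0 : 'rV[R]_(1 + m))) +
   (fun s => c s *m row_mx 0 1%:M).
by apply/funext => s; rewrite tptE.
Qed.

Lemma derive_tpt_r {m n} (f : 'rV[R]_(1 + m) -> 'rV[R]_n) (t : R) y w :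
  'D_(tpt 0 w) f (tpt t y) = 'D_w (fun y => f (tpt t y)) y.
Proof.
rewrite /derive; set F := (X in lim (X @ _) = _); set G := (X in _ = lim (X @ _)).
suff -> : F = G by []; apply/funext => s; rewrite /F /G /=.
by rewrite /tpt scale_row_mx add_row_mx scale_scalar_mx mulr0 -raddfD add0r.
Qed.

Lemma derive_tpt_l {m n} (f : 'rV[R]_(1 + m) -> 'rV[R]_n) (t : R) y w :
  differentiable f (tpt t y) -> is_derive t 1 (fun s => f (tpt s y)) w ->
  'D_(tpt 1 0) f (tpt t y) = w.
Proof.
move=> df dw.
have dc : is_derive t 1 (fun _ : R => y) 0 by exact: is_derive_cst.
have [_ <-] := is_derive_comp1 (is_derive_tpt dc) df.
by have [_ ->] := dw.
Qed.

End Curves.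

#[local] Opaque derive.

Section Velocity.
Context {R : realType}.

Lemma velocityP {n} {N : manifold R n} (c : R -> N) (t : R) w :
  velocity setT c t w <->
  c @ t --> c t /\ is_derive t 1 (fun s => chart (c t) (c s)) w.
Proof. by rewrite /velocity !withinET -is_derive_cvg. Qed.

Lemma velocityW {n} {N : manifold R n} (I : set R) (c c' : R -> N) (t : R) w :
  velocity setT c t w -> I t -> (forall s, I s -> c' s = c s) -> velocity I c' t w.
Proof.
rewrite /velocity !withinET => -[cc dc] It E; rewrite E //; split.
  apply: cvg_trans (@cvg_within_filter _ _ _ _ _ _ I cc).
  by apply: near_eq_cvg; rewrite near_withinE; apply: nearW => s Is; rewrite E.
apply: cvg_trans (@cvg_within_filter _ _ _ _ _ _ I dc).
by apply: near_eq_cvg; rewrite near_withinE; apply: nearW => s Is; rewrite E.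
Qed.

Lemma near_curve {n} {N : manifold R n} (c : R -> N) (t : R) p :
  c @ t --> c t -> cdom p (c t) -> \forall s \near t, cdom p (c s).
Proof. by move=> cc pc; exact: (cc _ (near_cdom pc)). Qed.

Lemma is_derive_near {W : normedModType R} (f f' : R -> W) (t : R) w :
  (\forall s \near t, f s = f' s) -> is_derive t 1 f w -> is_derive t 1 f' w.
Proof. exact: near_eq_is_derive. Qed.

Lemma is_derive_map {m n} {M : manifold R m} {N : manifold R n} (f : M -> N)
    (c : R -> M) (t : R) p q w :
  smooth_map f -> c @ t --> c t -> cdom p (c t) -> cdom q (f (c t)) ->
  is_derive t 1 (fun s => chart p (c s)) w ->
  is_derive t 1 (fun s => chart q (f (c s))) (w *m Dloc f p q (c t)).
Proof.
move=> sf cc pc qc dc.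
have sl := smooth_loc_chart sf pc qc.
have D := is_derive_comp1 dc (smooth_at_diff sl).
rewrite derive_loc // in D.
apply: is_derive_near D; have := near_curve cc pc; apply: filterS => s ps.
by rewrite loc_chart.
Qed.

Lemma is_derive_unique {W : normedModType R} (f : R -> W) (t : R) w w' :
  is_derive t 1 f w -> is_derive t 1 f w' -> w = w'.
Proof. by move=> [_ <-] [_ <-]. Qed.

Section Flows.
Context {n : nat} {N : manifold R n}.

(* Differentiate [phi_(s + t) = phi_t o phi_s] at [s = 0]. *)
Lemma flow_invariant (phi : R -> N -> N) V t y :
  (forall s t y, phi (s + t) y = phi s (phi t y)) ->
  (forall t, smooth_map (phi t)) -> generated_by phi V ->
  V (phi t y) = V y *m Dloc (phi t) y (phi t y) y.
Proof.
move=> add sphi [phi0 gen].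
have [c0 d0] := (velocityP _ _ _).1 (gen 0 y).
have [ct dt] := (velocityP _ _ _).1 (gen t y).
rewrite phi0 in c0 d0.
have yy : cdom y (phi 0 y) by rewrite phi0; exact: mem_cdom.
have qq : cdom (phi t y) (phi t (phi 0 y)) by rewrite phi0; exact: mem_cdom.
have c0' : (fun s => phi s y) @ (0 : R) --> phi 0 y by rewrite phi0.
have D1 := is_derive_map (sphi t) c0' yy qq d0.
rewrite phi0 in D1.
apply: (@is_derive_unique _ (fun s => chart (phi t y) (phi t (phi s y))) 0 _ _ _ D1).
move/is_derive_cvg/cvg_dnbhs_shift: dt => dt; apply/is_derive_cvg.
have -> // : (fun s => (s - 0)^-1 *: (chart (phi t y) (phi t (phi s y)) -
     chart (phi t y) (phi t (phi 0 y)))) =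
  (fun s => (s + t - t)^-1 *: (chart (phi t y) (phi (s + t) y) - chart (phi t y) (phi t y))).
by apply/funext => s; rewrite subr0 addrK phi0 (addrC s t) add.
Qed.

End Flows.

Section CompositeVelocity.
Context {m n : nat} {M : manifold R m} {N : manifold R n}.

(** Chain rule on R x N along s |-> (s, v(psi_s x)). The tangent vector (1, w) splits into (1, 0),
    which yields V at phi_t(y), and (0, w), which yields dphi_t(w); [flow_invariant] puts both under
    dphi_t. *)
Lemma velocity_composite (psi : R -> M -> M) (v : M -> N) (phi : R -> N -> N) W V t x :
  smooth_family setT psi -> smooth_map v -> smooth_family setT phi ->
  (forall s t y, phi (s + t) y = phi s (phi t y)) ->
  (forall t, smooth_map (phi t)) ->
  generated_by psi W -> generated_by phi V ->
  velocity setT (fun s => phi s (v (psi s x))) t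
    ((V (v (psi t x)) + du_along v W (psi t x)) *m dmap (phi t) (v (psi t x))).
Proof.
move=> spsi sv sphi add smphi gpsi gphi; apply/velocityP.
have sU := smooth_family_composite spsi sv sphi.
have cU := smooth_family_continuous sU.
have c1 : (fun s => (s, x)) @ t --> (t, x).
  apply: (@cvg_pair_at _ _ _ id (fun=> x)); first exact: cvg_id.
  exact: cvg_cst.
split; first exact: (cvg_comp _ _ c1 (cU (t, x))).
set a := psi t x; set y := v a; set b := phi t y.
have [ca da] := (velocityP _ _ _).1 (gpsi.2 t x).
have aa := mem_cdom a; have yy := mem_cdom y; have bb := mem_cdom b.
have dy := is_derive_map sv ca aa yy da.
have sj : smooth_at (jloc phi y b) (tpt t (chart y y)) by exact: smooth_jloc_tpt.
have dj := smooth_at_diff sj.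
have D := is_derive_comp1 (is_derive_tpt dy) dj.
set w := W (psi t x) *m Dloc v a y a in D.
have Dt : 'D_(tpt 1 0) (jloc phi y b) (tpt t (chart y y)) = V b.
  have [cb db] := (velocityP _ _ _).1 (gphi.2 t y).
  apply: derive_tpt_l => //.
  have <- : (fun s => chart b (phi s y)) = fun s => jloc phi y b (tpt s (chart y y)).
    by apply/funext => s; rewrite jloc_tpt.
  exact: db.
have Dw : 'D_(tpt 0 w) (jloc phi y b) (tpt t (chart y y)) = w *m Dloc (phi t) y b y.
  have Ej : (fun z => jloc phi y b (tpt t z)) = loc (phi t) y b.
    by apply/funext => z; rewrite /jloc tpt_l tpt_r.
  by rewrite derive_tpt_r Ej; exact: derive_loc.
have E : tpt 1 w = tpt 1 0 + tpt 0 w.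
  by rewrite (tptE 1 w) (tptE 0 w) scale0r add0r scale1r.
rewrite E (derive_addr _ _ dj) Dt Dw in D.
have VE : V b = V y *m Dloc (phi t) y b y by exact: flow_invariant.
rewrite VE -mulmxDl in D.
rewrite /du_along !dmapE.
apply: is_derive_near D.
have cv : (fun s => v (psi s x)) @ t --> v (psi t x) by exact: (cvg_comp _ _ ca (sv.1 _)).
have := near_curve cv yy; apply: filterS => s ys.
by rewrite jloc_tpt.
Qed.

End CompositeVelocity.
End Velocity.

(** * Invariance of the arc-length field in dimension one *)

Section UnitField.
Context {R : realType} {m : nat} {M : manifold R m}.
Context {g : M -> 'M[R]_m} (rg : riemannian_metric g).
Context {E : M -> 'rV[R]_m} (sE : smooth_vector_field E).
Context {psi : R -> M -> M} (spsi : smooth_family setT psi).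
Context (ipsi : forall t, isometric g g (psi t)).

(* In dimension one this takes its values in {1, -1}; continuity in [t] then
   excludes that an isometry [psi t] reverses the unit field. *)
Definition flow_product (x : M) (t : R) : R :=
  ip (g (psi t x)) (E x *m Dloc (psi t) x (psi t x) x) (E (psi t x)).

(** The product is formed in the chart of the moving point psi_t(x). For times near t it is
    rewritten in the fixed chart [p], where it is the smooth function [Th] evaluated along s |-> (s,
    y). *)
Lemma flow_product_continuous x : continuous (flow_product x).
Proof.
move=> t; pose p := psi t x; pose y := chart x x.
have pp : cdom p (psi t x) by exact: mem_cdom.
have xx := mem_cdom x.
have sj : smooth_at (jloc psi x p) (tpt t y) by exact: smooth_jloc_tpt.
have jE : jloc psi x p (tpt t y) = chart p (psi t x) by rewrite jloc_tpt.
pose Th z := ip (mrep g p (jloc psi x p z)) ('D_(tpt 0 (E x)) (jloc psi x p) z)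
  (field_rep E p (jloc psi x p z)).
have sTh : smooth_at Th (tpt t y).
  apply: smooth_at_ip.
  - by apply: (smooth_at_comp sj); rewrite jE; apply: (metric_at_rep rg pp).1.
  - exact: smooth_at_deriv.
  - by apply: (smooth_at_comp sj); rewrite jE; exact: smooth_at_field_rep.
have cpsi := smooth_family_continuous spsi.
have c1 : (fun s => (s, x)) @ t --> (t, x).
  apply: (@cvg_pair_at _ _ _ id (fun=> x)); first exact: cvg_id.
  exact: cvg_cst.
have ct : (fun s => psi s x) @ t --> psi t x := cvg_comp _ _ c1 (cpsi (t, x)).
have nE : \forall s \near t, Th (tpt s y) = flow_product x s.
  have := near_curve ct pp; apply: filterS => s ps.
  rewrite /Th jloc_tpt // ip_mrep // field_repE // /flow_product.
  have ss := mem_cdom (psi s x).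
  have -> : E (psi s x) *m trans (psi s x) p (psi s x) *m trans p (psi s x) (psi s x)
      = E (psi s x) by rewrite -mulmxA trans_comp // trans_id // mulmx1.
  have -> : 'D_(tpt 0 (E x)) (jloc psi x p) (tpt s y) = E x *m Dloc (psi s) x p x.
    have Ej : (fun z => jloc psi x p (tpt s z)) = loc (psi s) x p.
      by apply/funext => z; rewrite /jloc tpt_l tpt_r.
    by rewrite derive_tpt_r Ej; exact: derive_loc (ipsi s).1 _ _.
  have E2 := @Dloc_comp _ _ _ _ M M M (psi s) id x p (psi s x) x (ipsi s).1 smooth_map_id xx ps ss.
  by rewrite -mulmxA /trans -[in LHS]E2.
have d0 : is_derive t 1 (fun _ : R => y) 0 by exact: is_derive_cst.
have [dpt _] := is_derive_tpt d0.
have cpt : {for t, continuous (fun s => tpt s y)}.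
  by apply: differentiable_continuous; apply/derivable1_diffP.
have cTh : {for t, continuous (fun s => Th (tpt s y))}.
  by apply: continuous_comp; [exact: cpt|exact: smooth_at_continuous].
have E0 := nbhs_singleton nE.
suff : flow_product x @ t --> flow_product x t by [].
by rewrite -E0; apply: cvg_trans cTh; exact: near_eq_cvg.
Qed.

End UnitField.

Lemma ip_1dim {R : realType} (A : 'M[R]_1) (X Y : 'rV[R]_1) :
  ip A X Y = X 0 0 * A 0 0 * Y 0 0.
Proof. by rewrite ip_expand !big_ord1; ring. Qed.

Lemma unit_field_invariant {R : realType} {M : manifold R 1} (g : M -> 'M[R]_1)
    (E : M -> 'rV[R]_1) (psi : R -> M -> M) (t : R) (x : M) :
  riemannian_metric g -> smooth_vector_field E -> (forall x, ip (g x) (E x) (E x) = 1) ->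
  smooth_family setT psi -> (forall y, psi 0 y = y) -> (forall t, isometric g g (psi t)) ->
  0 <= t -> E x *m Dloc (psi t) x (psi t x) x = E (psi t x).
Proof.
move=> rg sE uE spsi psi0 ipsi t0.
have cf := @flow_product_continuous _ _ _ g rg E sE psi spsi ipsi x.
have uD s : ip (g (psi s x)) (E x *m Dloc (psi s) x (psi s x) x)
    (E x *m Dloc (psi s) x (psi s x) x) = 1 by rewrite (ipsi s).2.
(* In dimension one Cauchy-Schwarz is an equality, so the product of two unit vectors squares to
   1. *)
have sq s : flow_product (g := g) (E := E) (psi := psi) x s ^+ 2 = 1.
  have := uD s; have := uE (psi s x); rewrite /flow_product !ip_1dim.
  set a := (_ *m _) 0 0; set b := E _ 0 0; set c := g _ 0 0 => h1 h2.
  transitivity ((a * c * a) * (b * c * b)); first by ring.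
  by rewrite h1 h2 mulr1.
have f0 : flow_product (g := g) (E := E) (psi := psi) x 0 = 1.
  have p0 : psi 0 = id by apply/funext.
  have := trans_id (mem_cdom x); rewrite /flow_product p0 /trans => ->.
  by rewrite mulmx1 uE.
have ft : flow_product (g := g) (E := E) (psi := psi) x t = 1.
  have /eqP := sq t; rewrite -[X in _ == X](expr1n _ 2) eqf_sqr => /orP[/eqP//|/eqP ft].
  (* Were the value -1 at [t], the intermediate value theorem would give a zero on [0, t], against
     [sq]. *)
  have cw : {within `[0, t]%classic, continuous (flow_product (g := g) (E := E) (psi := psi) x)}.
    exact: continuous_subspaceT.
  have [] := @IVT _ _ 0 t 0 t0 cw.
    by rewrite f0 ft ge_min le_max lerN10 orbT ler01.
  by move=> c _ fc; have := sq c; rewrite fc expr0n /= => /esym/eqP; rewrite oner_eq0.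
move: ft; rewrite /flow_product => ft.
have h1 := uD t; have h2 := uE (psi t x).
move: ft h1 h2; rewrite !ip_1dim => ft h1 h2.
apply/rowP => i; rewrite ord1.
(* The squared length of the difference of the two unit vectors is 1 + 1 - 2 = 0. *)
have : ((E x *m Dloc (psi t) x (psi t x) x) 0 0 - E (psi t x) 0 0) ^+ 2 * g (psi t x) 0 0 = 0.
  move: ft h1 h2; set a := (_ *m _) 0 0; set b := E _ 0 0; set c := g _ 0 0 => ft h1 h2.
  transitivity (a * c * a + b * c * b - 2 * (a * c * b)); first by ring.
  by rewrite ft h1 h2; lra.
move/eqP; rewrite mulf_eq0 sqrf_eq0 subr_eq0 => /orP[/eqP//|/eqP c0].
by move: h2; rewrite c0 mulr0 mul0r => /esym/eqP; rewrite oner_eq0.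
Qed.

(** * Solitons *)

(** Because T > 0, the point 0 is an accumulation point of [I], so the punctured one-sided filter is
    proper and its limits are unique. *)
Lemma velocity_unique {R : realType} {n} {N : manifold R n} (T : \bar R) (c : R -> N) w w' :
  (0 < T)%E -> let I : set R := [set t | 0 <= t /\ (t%:E < T)%E] in
  velocity I c 0 w -> velocity I c 0 w' -> w = w'.
Proof.
move=> T0 I [_ H] [_ H'].
have PF : ProperFilter (within I (0 : R)^').
  split; last exact: within_filter.
  move=> H0.
  have : \forall s \near (0 : R), s != 0 -> I s -> False by exact: H0.
  move=> /nbhs_ballP[e /= e0 He].
  (* A finite positive time below [T], which may be infinite; the minimum with [e / 2] then lies in
     [I] and in the given ball. *)
  have [d [d0 dT]] : exists d : R, 0 < d /\ (d%:E < T)%E.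
    case: T T0 @I {H H' H0 He} => [r| |] //=; rewrite ?lte_fin.
    - by move=> r0; exists (r / 2); rewrite lte_fin divr_gt0 // ltr_pdivrMr // ltr_pMr // ltr1n.
    - by move=> _; exists 1; rewrite ltr01 ltry.
  pose s := Num.min d (e / 2).
  have s0 : 0 < s by rewrite lt_min d0 divr_gt0.
  have sd : s <= d by rewrite ge_min lexx.
  apply: (He s).
  - rewrite /ball /= sub0r normrN gtr0_norm //.
    by rewrite gt_min ltr_pdivrMr // ltr_pMr // ltr1n orbT.
  - by rewrite gt_eqF.
  - by split; [exact: ltW|apply: le_lt_trans dT; rewrite lee_fin].
exact: (cvg_unique (@norm_hausdorff _ _) H H').
Qed.

(** The operator [tau] is abstract and enters through its naturality under phi_t and psi_t for t >=
    0, so that one argument serves both flows. *)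
Lemma soliton_iff {R : realType} {m k} {M : manifold R m} {N : manifold R (k + k)}
    (g : M -> 'M[R]_m) (h : N -> 'M[R]_(k + k)) W V
    (psi : R -> M -> M) (phi : R -> N -> N) (v : M -> N)
    (tau : (M -> N) -> M -> 'rV[R]_(k + k)) (T : \bar R) (u : R -> M -> N) :
  isometry_group g psi -> generated_by psi W ->
  isometry_group h phi -> generated_by phi V -> holomorphic_flow phi ->
  smooth_map v -> (0 < T)%E ->
  (forall t x, 0 <= t -> (t%:E < T)%E -> u t x = phi t (v (psi t x))) ->
  (forall t x, 0 <= t -> tau (phi t \o v \o psi t) x =
     tau v (psi t x) *m dmap (phi t) (v (psi t x))) ->
  geometric_soliton g h tau [set t | 0 <= t /\ (t%:E < T)%E] u <->
  forall x, cplxJ (tau v x) = V (v x) + du_along v W x.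
Proof.
move=> hpsi psiW hphi phiV hol sv T0 hu tau_nat.
set I := [set t | _].
have [spsi psi0 _ _] := hpsi; have [sphi phi0 addphi iphi] := hphi.
have smphi t : smooth_map (phi t) by have [[]] := iphi t.
have uI t x : I t -> u t x = phi t (v (psi t x)) by move=> [t0 tT]; exact: hu.
have vel t x : I t -> velocity I (u ^~ x) t
    ((V (v (psi t x)) + du_along v W (psi t x)) *m dmap (phi t) (v (psi t x))).
  move=> It; apply: velocityW It (fun s => @uI s x).
  exact: velocity_composite.
have tauE t x : I t -> tau (u t) x = tau v (psi t x) *m dmap (phi t) (v (psi t x)).
  move=> It; rewrite -tau_nat; last by case: It.
  by congr (tau _ x); apply/funext => y; rewrite uI.
have I0 : I 0 by split.
split=> [[[_ sol] _] x|eqv].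
  have := velocity_unique T0 (sol 0 x I0) (vel 0 x I0).
  rewrite tauE // psi0 (_ : phi 0 = id); last by apply/funext.
  by rewrite dmap_id !mulmx1.
split; last first.
  by exists psi, phi, v; split => // t x It; exact: uI.
split; first exact: smooth_familyW (smooth_family_composite spsi sv sphi) uI.
by move=> t x It; rewrite tauE // hol eqv; exact: vel.
Qed.

Theorem theorem4p1 (R : realType) (m k : nat)
  (M : manifold R m) (g : M -> 'M[R]_m) (hg : riemannian_metric g)
  (N : manifold R (k + k)) (hN : complex_atlas N)
  (h : N -> 'M[R]_(k + k)) (hh : kaehler_metric h)
  (W : M -> 'rV[R]_m) (hW : killing_field g W)
  (psi : R -> M -> M) (hpsi : isometry_group g psi)
  (psiW : generated_by psi W)
  (V : N -> 'rV[R]_(k + k)) (hV : killing_field h V)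
  (phi : R -> N -> N) (hphi : isometry_group h phi)
  (phiV : generated_by phi V) (hol : holomorphic_flow phi)
  (v : M -> N) (hv : smooth_map v)
  (T : \bar R) (T0 : (0 < T)%E)
  (u : R -> M -> N)
  (hu : forall t x, 0 <= t -> (t%:E < T)%E -> u t x = phi t (v (psi t x))) :
  let I : set R := [set t | 0 <= t /\ (t%:E < T)%E] in
  (geometric_soliton g h (tension g h) I u <->
     forall x, cplxJ (tension g h v x) = V (v x) + du_along v W x)
  /\
  (m = 1%N -> line_or_circle M ->
   forall E : M -> 'rV[R]_m, arclength_field g E ->
   (geometric_soliton g h (tau2 h E) I u <->
      forall x, cplxJ (tau2 h E v x) = V (v x) + du_along v W x)).
Proof.
have [rh _ _] := hh; have [spsi psi0 _ ipsi] := hpsi; have [_ _ _ iphi] := hphi.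
have {}iphi t := isometry_isometric (iphi t).
have {}ipsi t := isometry_isometric (ipsi t).
split=> [|m1 _ E [sE uE]].
  apply: (soliton_iff hpsi psiW hphi phiV hol hv T0 hu) => t x _; have [sp _] := ipsi t.
  apply: etrans (tension_post (g := g) rh x (smooth_map_comp sp hv) (iphi t)) _.
  by rewrite (tension_pre hg x hv (ipsi t)).
have uE1 x : ip (g x) (E x) (E x) = 1 by rewrite -innerE.
apply: (soliton_iff hpsi psiW hphi phiV hol hv T0 hu) => t x t0.
apply: (tau2_natural rh x hv sE (iphi t) (ipsi t).1); last exact: hol.
(* The sign argument for the unit field is where dimension one enters. *)
by subst m => y; exact: (unit_field_invariant y hg sE uE1 spsi psi0 ipsi t0).
Qed.
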